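(* For every $b,h>0$, $r>1$ and every sufficiently small $\epsilon>0$, the system $$ \begin{aligned} u_t(t,x) &= u_{xx}(t,x) + u(t,x)\bigl(1-r-u(t,x)+r\,v(t-h,x)\bigr),\\ v_t(t,x) &= v_{xx}(t,x) + \bigl(b\,u(t,x)-\epsilon v(t,x)\bigr)\bigl(1-v(t,x)\bigr),\qquad u,v\ge 0,\ x\in\mathbb{R}, \end{aligned} $$ has a monotone bistable wavefront $u=\phi_\epsilon(x+c_*(\epsilon)t)$, $v=\psi_\epsilon(x+c_*(\epsilon)t)$ for some speed $c_*(\epsilon)\in\mathbb{R}$.
   Context: A monotone bistable wavefront with speed $c\in\mathbb{R}$ is a classical solution $(u,v)(t,x)=(\phi,\psi)(x+ct)$ of the system such that $\phi,\psi:\mathbb{R}\to[0,1]$ are nondecreasing and $(\phi,\psi)(-\infty)=(0,0)$, $(\phi,\psi)(+\infty)=(1,1)$. Equivalently, $(\phi,\psi)$ is a $C^2$ solution, nondecreasing in each component and with these limits, of $$ \begin{aligned} &\phi''(t)-c\phi'(t)+\phi(t)\bigl(1-r-\phi(t)+r\psi(t-ch)\bigr)=0,\\ &\psi''(t)-c\psi'(t)+\bigl(b\phi(t)-\epsilon\psi(t)\bigr)\bigl(1-\psi(t)\bigr)=0,\qquad t\in\mathbb{R}. \end{aligned} $$ ''Sufficiently small $\epsilon$'' means: there is $\bar\epsilon=\bar\epsilon(b,h,r)>0$ such that the assertion holds for all $\epsilon\in(0,\bar\epsilon)$. *)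

(* Defs.v *)
From Stdlib Require Import Reals.
From Coquelicot Require Import Coquelicot.
Open Scope R_scope.

(* A function of time and space is curried, [u t x]. *)
Definition dt (u : R -> R -> R) (t x : R) : R := Derive (fun s => u s x) t.
Definition dx (u : R -> R -> R) (t x : R) : R := Derive (fun y => u t y) x.
Definition dxx (u : R -> R -> R) (t x : R) : R := dx (dx u) t x.

(* Class C^{1,2} on the whole (t,x)-plane. [Derive] is total, so existence of
   each partial derivative has to be required separately. *)
Definition C12 (u : R -> R -> R) : Prop :=
  forall t x : R,
    ex_derive (fun s => u s x) t /\
    ex_derive (fun y => u t y) x /\
    ex_derive (fun y => dx u t y) x /\
    continuity_2d_pt u t x /\
    continuity_2d_pt (dt u) t x /\
    continuity_2d_pt (dx u) t x /\
    continuity_2d_pt (dxx u) t x.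

Definition classical_solution (b h r eps : R) (u v : R -> R -> R) : Prop :=
  C12 u /\ C12 v /\
  forall t x : R,
    0 <= u t x /\ 0 <= v t x /\
    dt u t x = dxx u t x + u t x * (1 - r - u t x + r * v (t - h) x) /\
    dt v t x = dxx v t x + (b * u t x - eps * v t x) * (1 - v t x).

(* The Stdlib predicate [increasing] is the non-strict one:
   [x <= y -> f x <= f y]. *)
Definition monotone_bistable_wavefront
    (b h r eps c : R) (phi psi : R -> R) : Prop :=
  classical_solution b h r eps
    (fun t x => phi (x + c * t)) (fun t x => psi (x + c * t)) /\
  (forall s : R, 0 <= phi s <= 1 /\ 0 <= psi s <= 1) /\
  increasing phi /\ increasing psi /\
  is_lim phi m_infty 0 /\ is_lim psi m_infty 0 /\
  is_lim phi p_infty 1 /\ is_lim psi p_infty 1.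

(* Main.v *)
Require Import Defs.
From Stdlib Require Import Reals Lra Classical ClassicalEpsilon FunctionalExtensionality.
From Corelib Require Import ssreflect.
From mathcomp Require filter.
From Coquelicot Require Import Coquelicot.
Open Scope R_scope.

(** Write the profile equations as phi'' - c phi' + f(phi(t), psi(t - c h)) = 0
    and psi'' - c psi' + g(phi, psi) = 0.  On the unit square f is nondecreasing
    in psi and g in phi, so the system obeys comparison principles, and its
    equilibria there are (0,0), (0,1), (1,1) and an intermediate state whose
    second component is b (r - 1) / (b r - eps), which exceeds (r - 1) / r.

    The decisive fact is that a wave with nonnegative speed cannot end in the
    wrong state.  Let (phi, psi) be an entire nondecreasing solution with values
    in the unit square, c >= 0 and psi(0) = (r - 1) / r.  Its limits at both ends
    are equilibria.  The value of psi(0) leaves only (0,0) at minus infinity and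
    leaves (0,1), (1,1) and the intermediate state at plus infinity.  If the
    limit were (0,1), then phi = 0 and psi' - c psi would start from 0,
    be nondecreasing, and force psi to grow without bound
    ([no_front_with_vanishing_phi]).  If it were the intermediate state, a
    positive combination z of the two distances to it would satisfy
    z'' - c z' <= 0 near plus infinity, because the state is unstable and the
    delay, c h being nonnegative, only helps; as z decreases to 0 and c >= 0,
    this forces z = 0, and then phi is constant by the strong maximum principle
    ([no_front_to_intermediate_state]).  So the wave joins (0,0) to (1,1), and it
    remains to produce one solution of this kind.

    Solutions on [-a, a], extended by 0 on the left and by 1 on the right, come
    from the Knaster-Tarski theorem applied to the monotone operator that solves
    the linearly damped equations, acting on pairs of functions with a common
    Lipschitz constant: such pairs are closed under infima, so no limit is taken
    ([truncated_front_exists]).  Sliding one solution over another shows that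
    the solution is nondecreasing and unique for each speed
    ([truncated_front_increasing], [truncated_front_unique]).  For c = 3 + b the
    function exp(t - a) is a supersolution, hence psi(0) <= exp(-a)
    ([fast_front_low]).

    For c = 0 and small eps, psi(0) > (r - 1) / r for all large a; this is where
    the smallness of eps enters ([standing_front_high]).  Otherwise
    psi'^2 - eps psi^2 is nonincreasing from a point with tiny slope on, so psi'
    stays below a small constant k, and psi needs a time of order 1 / k to cross a
    fixed range of values close to 1.  In that range the equation for phi has growth rate at
    least 1/2 at phi = 0, which drives the nondecreasing function phi above 1/4
    within time 5.  After that psi'' is below a fixed negative number for a
    time of order 1 / k, and psi' becomes negative, a contradiction.

    Between the speeds 0 and 3 + b a supremum argument, compactness and
    uniqueness give a speed for which psi(0) = (r - 1) / r exactly
    ([balanced_truncated_front]).  All bounds are uniform in a, and letting a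
    tend to infinity gives the required entire solution
    ([entire_front_exists]).  The limits are taken along an ultrafilter on nat:
    bounded sequences converge along it, so pointwise limits of whole families
    of functions exist at once, and uniform Lipschitz bounds turn pointwise
    limits into limits of derivatives ([derive_of_tends]). *)

(** * Calculus on the line and maximum principles *)

Ltac derive_value d :=
  match goal with |- is_derive _ _ ?l => replace l with d by ring end.

(** The derivative is taken at an interior point: the differential equations
    below hold on open intervals only, and profiles have corners at the ends. *)
Lemma mean_value (f f' : R -> R) (s t : R) :
  s < t ->
  (forall x, s < x < t -> is_derive f x (f' x)) ->
  (forall x, s <= x <= t -> continuous f x) ->
  exists x, s < x < t /\ f t - f s = f' x * (t - s).
Proof.
  intros Hst Hd Hc.
  assert (pr : forall x, s < x < t -> derivable_pt f x).
  { intros x Hx. exists (f' x). apply is_derive_Reals. now apply Hd. }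
  assert (pi : forall x, s < x < t -> derivable_pt id x)
    by (intros; apply derivable_pt_id).
  destruct (MVT f id s t pr pi Hst) as [x [Hx E]].
  - intros x Hx. apply continuity_pt_filterlim. now apply Hc.
  - intros x _. apply derivable_continuous_pt, derivable_pt_id.
  - exists x. split; [exact Hx|].
    replace (derive_pt id x (pi x Hx)) with 1 in E.
    2:{ symmetry. apply derive_pt_eq_0. apply derivable_pt_lim_id. }
    replace (derive_pt f x (pr x Hx)) with (f' x) in E.
    2:{ symmetry. apply derive_pt_eq_0. apply is_derive_Reals. now apply Hd. }
    unfold id in E. lra.
Qed.

Lemma derive_continuous (f : R -> R) (x l : R) : is_derive f x l -> continuous f x.
Proof. intros H. apply: ex_derive_continuous. now exists l. Qed.

Lemma nonincreasing_of_derive (f f' : R -> R) (s t : R) :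
  s <= t ->
  (forall x, s < x < t -> is_derive f x (f' x) /\ f' x <= 0) ->
  (forall x, s <= x <= t -> continuous f x) ->
  f t <= f s.
Proof.
  intros Hst Hd Hc. destruct (Req_dec s t) as [->|N]; [lra|].
  destruct (mean_value f f' s t) as [x [Hx E]]; try assumption; try lra.
  - intros x Hx. now apply Hd.
  - destruct (Hd x Hx) as [_ Hn]. nra.
Qed.

Lemma nondecreasing_of_derive (f f' : R -> R) (s t : R) :
  s <= t ->
  (forall x, s < x < t -> is_derive f x (f' x) /\ 0 <= f' x) ->
  (forall x, s <= x <= t -> continuous f x) ->
  f s <= f t.
Proof.
  intros Hst Hd Hc. destruct (Req_dec s t) as [->|N]; [lra|].
  destruct (mean_value f f' s t) as [x [Hx E]]; try assumption; try lra.
  - intros x Hx. now apply Hd.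
  - destruct (Hd x Hx) as [_ Hn]. nra.
Qed.

Definition lip (L : R) (f : R -> R) : Prop :=
  forall s t, Rabs (f s - f t) <= L * Rabs (s - t).

Lemma lip_continuous (L : R) (f : R -> R) :
  lip L f -> forall x, continuous f x.
Proof.
  intros H x. apply continuity_pt_filterlim. intros e He.
  assert (0 < Rabs L + 1) by (pose proof (Rabs_pos L); lra).
  exists (e / (Rabs L + 1)). split; [apply Rdiv_lt_0_compat; lra|].
  intros y [_ Hy]. simpl in *. unfold R_dist in *.
  apply Rle_lt_trans with (1 := H y x).
  apply Rle_lt_trans with ((Rabs L + 1) * Rabs (y - x)).
  - apply Rmult_le_compat_r; [apply Rabs_pos|]. pose proof (Rle_abs L). lra.
  - apply Rmult_lt_reg_r with (/ (Rabs L + 1)); [now apply Rinv_0_lt_compat|].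
    unfold Rdiv in Hy. field_simplify; try lra.
Qed.

Lemma lip_ge_of_right (L m t : R) (x : R -> R) :
  lip L x -> (forall s, t < s -> m <= x s) -> m <= x t.
Proof.
  intros Lx H. apply Rnot_lt_le. intros N.
  set (L' := Rabs L + 1). assert (HL : 0 < L') by (unfold L'; pose proof (Rabs_pos L); lra).
  set (d := (m - x t) / (2 * L')).
  assert (0 < d) by (apply Rdiv_lt_0_compat; lra).
  assert (A := H (t + d) ltac:(lra)). assert (B := Lx (t + d) t).
  replace (t + d - t) with d in B by ring.
  rewrite (Rabs_pos_eq d) in B; [|lra]. apply Rabs_le_between in B.
  assert (L' * d = (m - x t) / 2) by (unfold d; field; lra).
  assert (L * d <= L' * d).
  { apply Rmult_le_compat_r; [lra|]. unfold L'. pose proof (Rle_abs L). lra. }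
  lra.
Qed.

Lemma derive_pos_increases (f : R -> R) (t d : R) :
  is_derive f t d -> 0 < d ->
  exists eta, 0 < eta /\ (forall s, t < s < t + eta -> f t < f s) /\
    (forall s, t - eta < s < t -> f s < f t).
Proof.
  intros H Hd. apply is_derive_Reals in H.
  destruct (H d Hd) as [eta Heta]. exists eta.
  split; [apply cond_pos|].
  split; intros s Hs.
  - assert (A : Rabs ((f (t + (s - t)) - f t) / (s - t) - d) < d).
    { apply Heta; [lra|]. rewrite Rabs_pos_eq; lra. }
    replace (t + (s - t)) with s in A by ring.
    apply Rabs_lt_between in A.
    assert (0 < (f s - f t) / (s - t)) as B by lra.
    assert (f s - f t = (f s - f t) / (s - t) * (s - t)) by (field; lra). nra.
  - assert (A : Rabs ((f (t + (s - t)) - f t) / (s - t) - d) < d).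
    { apply Heta; [lra|]. rewrite Rabs_left; lra. }
    replace (t + (s - t)) with s in A by ring.
    apply Rabs_lt_between in A.
    assert (0 < (f s - f t) / (s - t)) as B by lra.
    assert (f s - f t = (f s - f t) / (s - t) * (s - t)) by (field; lra). nra.
Qed.

Lemma derive_zero_at_min (f : R -> R) (l u t d : R) :
  l < t < u -> is_derive f t d -> (forall s, l < s < u -> f t <= f s) -> d = 0.
Proof.
  intros Ht H Hm.
  destruct (Rtotal_order d 0) as [N|[E|P]]; [exfalso| exact E |exfalso].
  - destruct (derive_pos_increases (fun s => - f s) t (- d)) as [eta [He [A _]]].
    { now apply: is_derive_opp. } { lra. }
    set (s := t + Rmin (eta / 2) ((u - t) / 2)).
    assert (0 < Rmin (eta / 2) ((u - t) / 2)) by (apply Rmin_glb_lt; lra).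
    pose proof (Rmin_l (eta / 2) ((u - t) / 2)).
    pose proof (Rmin_r (eta / 2) ((u - t) / 2)).
    specialize (A s). specialize (Hm s). unfold s in *. lra.
  - destruct (derive_pos_increases f t d H P) as [eta [He [_ A]]].
    set (s := t - Rmin (eta / 2) ((t - l) / 2)).
    assert (0 < Rmin (eta / 2) ((t - l) / 2)) by (apply Rmin_glb_lt; lra).
    pose proof (Rmin_l (eta / 2) ((t - l) / 2)).
    pose proof (Rmin_r (eta / 2) ((t - l) / 2)).
    specialize (A s). specialize (Hm s). unfold s in *. lra.
Qed.

(** The equation x'' - c x' + g = 0 on the open interval.  The source term g is a
    function of t, so that each component of the system, whatever its coupling and
    delay, is an instance. *)
Definition ode_on (l u c : R) (x g : R -> R) : Prop :=
  forall t, l < t < u ->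
    ex_derive x t /\ is_derive (Derive x) t (c * Derive x t - g t).

Lemma ode_on_sub (l u l' u' c : R) (x g : R -> R) :
  ode_on l u c x g -> l <= l' -> u' <= u -> ode_on l' u' c x g.
Proof. intros H Hl Hu t Ht. apply H. lra. Qed.

Lemma ode_on_ext (l u c : R) (x g k : R -> R) :
  ode_on l u c x g -> (forall t, l < t < u -> g t = k t) -> ode_on l u c x k.
Proof. intros H E t Ht. rewrite <- (E t Ht). now apply H. Qed.

Lemma locally_between (l u t : R) :
  l < t < u -> locally t (fun s => l < s < u).
Proof.
  intros H. apply: (locally_interval _ t l u); simpl; try lra.
  intros; lra.
Qed.

(** [ode_on] speaks of [Derive]; this allows solutions to be given together with
    an explicit formula for the first derivative. *)
Lemma ode_on_of_derives (l u c : R) (x x1 g : R -> R) :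
  (forall t, l < t < u -> is_derive x t (x1 t)) ->
  (forall t, l < t < u -> is_derive x1 t (c * x1 t - g t)) ->
  ode_on l u c x g.
Proof.
  intros H1 H2 t Ht. split.
  - exists (x1 t). now apply H1.
  - rewrite (is_derive_unique _ _ _ (H1 t Ht)).
    apply is_derive_ext_loc with x1; [|now apply H2].
    apply: filter_imp (locally_between l u t Ht) => s Hs.
    symmetry. apply is_derive_unique. now apply H1.
Qed.

Lemma ode_on_derive (l u c : R) (x g : R -> R) :
  ode_on l u c x g -> forall t, l < t < u -> is_derive x t (Derive x t).
Proof. intros H t Ht. apply Derive_correct. now apply H. Qed.

Lemma ode_on_minus (l u c : R) (x y g k : R -> R) :
  ode_on l u c x g -> ode_on l u c y k ->
  ode_on l u c (fun t => x t - y t) (fun t => g t - k t).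
Proof.
  intros Hx Hy.
  apply ode_on_of_derives with (fun t => Derive x t - Derive y t); intros t Ht.
  - apply: is_derive_minus; eapply ode_on_derive; eauto.
  - replace (_ - _) with
      ((c * Derive x t - g t) - (c * Derive y t - k t)) by ring.
    apply: is_derive_minus; [now apply Hx|now apply Hy].
Qed.

Lemma ode_on_const (l u c k : R) : ode_on l u c (fun _ => k) (fun _ => 0).
Proof.
  apply ode_on_of_derives with (fun _ => 0); intros t _.
  - apply: is_derive_const.
  - replace (_ - _) with 0 by ring. apply: is_derive_const.
Qed.

Lemma ode_on_shift (l u c s : R) (x g : R -> R) :
  ode_on l u c x g ->
  ode_on (l - s) (u - s) c (fun t => x (t + s)) (fun t => g (t + s)).
Proof.
  intros H.
  assert (D : forall (f : R -> R) (t d : R), is_derive f (t + s) d ->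
                is_derive (fun t => f (t + s)) t d).
  { intros f t d Hd. replace d with (1 * d) by ring.
    apply: (is_derive_comp f (fun t => t + s)); [exact Hd|].
    replace 1 with (1 + 0) by ring.
    apply: is_derive_plus; [apply: is_derive_id|apply: is_derive_const]. }
  apply ode_on_of_derives with (fun t => Derive x (t + s)); intros t Ht; apply D.
  - eapply ode_on_derive; [exact H|lra].
  - apply H. lra.
Qed.

(** At a negative interior minimum the first derivative vanishes and the second
    is nonnegative, so it suffices to exclude that situation pointwise. *)
Lemma min_principle (l u : R) (x x1 x2 : R -> R) :
  l < u ->
  (forall t, l < t < u -> is_derive x t (x1 t) /\ is_derive x1 t (x2 t)) ->
  (forall t, l <= t <= u -> continuous x t) ->
  0 <= x l -> 0 <= x u ->
  (forall t, l < t < u -> x t < 0 -> x1 t = 0 -> x2 t < 0) ->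
  forall t, l <= t <= u -> 0 <= x t.
Proof.
  intros Hlu Hd Hc Hl Hu Hn.
  destruct (continuity_ab_min x l u) as [m [Hm Hmi]]; [lra| |].
  { intros y Hy. apply continuity_pt_filterlim. now apply Hc. }
  destruct (Rle_lt_dec 0 (x m)) as [P|N].
  { intros t Ht. specialize (Hm t Ht). lra. }
  exfalso.
  assert (Hin : l < m < u).
  { split.
    - destruct (Req_dec l m) as [E|]; [rewrite <- E in N; lra|lra].
    - destruct (Req_dec m u) as [E|]; [rewrite E in N; lra|lra]. }
  destruct (Hd m Hin) as [D1 D2].
  assert (Z : x1 m = 0).
  { apply (derive_zero_at_min x l u m); auto. intros s Hs. apply Hm. lra. }
  assert (P2 := Hn m Hin N Z).
  destruct (derive_pos_increases (fun s => - x1 s) m (- x2 m)) as [eta [He [A _]]].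
  { now apply: is_derive_opp. } { lra. }
  set (s := m + Rmin (eta / 2) ((u - m) / 2)).
  assert (0 < Rmin (eta / 2) ((u - m) / 2)) by (apply Rmin_glb_lt; lra).
  pose proof (Rmin_l (eta / 2) ((u - m) / 2)).
  pose proof (Rmin_r (eta / 2) ((u - m) / 2)).
  destruct (mean_value x x1 m s) as [y [Hy E]].
  - unfold s. lra.
  - intros y Hy. apply Hd. unfold s in Hy. lra.
  - intros y Hy. apply Hc. unfold s in Hy. lra.
  - specialize (Hm s). specialize (A y). unfold s in *.
    assert (x1 y < 0) by lra. nra.
Qed.

(** Take m with m (m - c) >= K.  Then the function exp((m - c) t) (x' - m x),
    which up to a positive factor is the derivative of z = exp(- m t) x, has
    derivative at most exp((m - c) t) (K - m (m - c)) x <= 0.  It vanishes at the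
    contact point t0, so z increases up to t0 and decreases after it; being
    nonnegative with z(t0) = 0, it is 0 on both sides. *)
Lemma strong_max_principle (l u c K : R) (x g : R -> R) (t0 : R) :
  0 <= c -> 0 <= K ->
  ode_on l u c x g ->
  (forall t, l < t < u -> - K * x t <= g t) ->
  (forall t, l <= t <= u -> 0 <= x t) ->
  (forall t, l <= t <= u -> continuous x t) ->
  l < t0 < u -> x t0 = 0 ->
  forall t, l <= t <= u -> x t = 0.
Proof.
  intros Hc HK Ho Hg Hp Hco Ht0 Z.
  assert (D1 := ode_on_derive _ _ _ _ _ Ho).
  assert (Z1 : Derive x t0 = 0).
  { apply (derive_zero_at_min x l u t0); auto.
    intros s Hs. rewrite Z. apply Hp. lra. }
  (* Large enough for m (m - c) >= K when c and K are nonnegative. *)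
  set (m := c + K + 1).
  assert (Hm : K <= m * (m - c)) by (unfold m; nra).
  assert (Dexp : forall a t, is_derive (fun t => exp (a * t)) t (a * exp (a * t))).
  { intros a t. auto_derive; [trivial|ring]. }
  set (w := fun t => (Derive x t - m * x t) * exp ((m - c) * t)).
  assert (Dw : forall t, l < t < u -> is_derive w t
     ((c * Derive x t - g t - m * Derive x t) * exp ((m - c) * t)
      + (Derive x t - m * x t) * ((m - c) * exp ((m - c) * t)))).
  { intros t Ht.
    apply: (is_derive_mult (fun t => Derive x t - m * x t)
             (fun t => exp ((m - c) * t))).
    - apply: is_derive_minus; [now apply Ho|].
      apply: is_derive_scal. now apply D1.
    - apply Dexp.
    - intros; apply Rmult_comm. }
  assert (Nw : forall t, l < t < u ->
     (c * Derive x t - g t - m * Derive x t) * exp ((m - c) * t)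
      + (Derive x t - m * x t) * ((m - c) * exp ((m - c) * t)) <= 0).
  { intros t Ht. assert (E := exp_pos ((m - c) * t)).
    replace (_ + _) with
      ((- g t - m * (m - c) * x t) * exp ((m - c) * t)) by ring.
    assert (A := Hg t Ht). assert (B := Hp t ltac:(lra)).
    assert (K * x t <= m * (m - c) * x t) by (apply Rmult_le_compat_r; lra).
    nra. }
  assert (w0 : w t0 = 0) by (unfold w; rewrite Z Z1; ring).
  set (z := fun t => x t * exp (- m * t)).
  assert (Dz : forall t, l < t < u ->
    is_derive z t ((Derive x t - m * x t) * exp (- m * t))).
  { intros t Ht. replace (_ * _) with
     (Derive x t * exp (- m * t) + x t * (- m * exp (- m * t))) by ring.
    apply: (is_derive_mult x (fun t => exp (- m * t))).
    - now apply D1.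
    - apply Dexp.
    - intros; apply Rmult_comm. }
  assert (Cz : forall t, l <= t <= u -> continuous z t).
  { intros t Ht. apply: continuous_mult; [now apply Hco|].
    eapply derive_continuous. apply Dexp. }
  assert (z0 : z t0 = 0) by (unfold z; rewrite Z; ring).
  intros t Ht.
  assert (zt : z t <= 0).
  { destruct (Rle_lt_dec t0 t) as [H|H].
    - rewrite <- z0.
      apply (nonincreasing_of_derive z
               (fun t => (Derive x t - m * x t) * exp (- m * t))); auto.
      + intros y Hy. split; [apply Dz; lra|].
        assert (w y <= w t0).
        { eapply nonincreasing_of_derive; [lra| |].
          - intros q Hq. split; [apply Dw; lra|apply Nw; lra].
          - intros q Hq. eapply derive_continuous. apply Dw. lra. }
        rewrite w0 in H0. unfold w in H0.
        assert (E := exp_pos ((m - c) * y)). assert (E' := exp_pos (- m * y)).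
        assert (Derive x y - m * x y <= 0) by nra. nra.
      + intros y Hy. apply Cz. lra.
    - rewrite <- z0.
      apply (nondecreasing_of_derive z
               (fun t => (Derive x t - m * x t) * exp (- m * t))); try lra.
      + intros y Hy. split; [apply Dz; lra|].
        assert (w t0 <= w y).
        { eapply nonincreasing_of_derive; [lra| |].
          - intros q Hq. split; [apply Dw; lra|apply Nw; lra].
          - intros q Hq. eapply derive_continuous. apply Dw. lra. }
        rewrite w0 in H0. unfold w in H0.
        assert (E := exp_pos ((m - c) * y)). assert (E' := exp_pos (- m * y)).
        assert (0 <= Derive x y - m * x y) by nra. nra.
      + intros y Hy. apply Cz. lra. }
  assert (P := Hp t Ht). unfold z in zt.
  assert (E := exp_pos (- m * t)). nra.
Qed.

(** * Monotone operators and the linear boundary value problem *)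

(** The infimum of all w in X with T w <= w is a fixed point of a monotone T.
    The operator is a relation, because for a boundary value problem one has
    solvability and comparison rather than a formula.  X only needs to be closed
    under infima, which suits sets of uniformly Lipschitz functions. *)
Lemma tarski_least_fixed_point (I : Type) (X : (I -> R) -> Prop)
    (T : (I -> R) -> (I -> R) -> Prop) :
  (forall w i, X w -> 0 <= w i) ->
  (forall (S : (I -> R) -> Prop) m, (exists w, S w) -> (forall w, S w -> X w) ->
     (forall w i, S w -> m i <= w i) ->
     (forall i k, (forall w, S w -> k <= w i) -> k <= m i) -> X m) ->
  (forall w, X w -> exists w', T w w' /\ X w') ->
  (forall w1 w2 w1' w2', X w1 -> X w2 -> T w1 w1' -> T w2 w2' ->
     (forall i, w1 i <= w2 i) -> forall i, w1' i <= w2' i) ->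
  (exists w w', X w /\ T w w' /\ forall i, w' i <= w i) ->
  exists w, X w /\ T w w.
Proof.
  intros Hpos Hinf Htot Hmon Htop.
  set (S := fun w => X w /\ exists w', T w w' /\ forall i, w' i <= w i).
  assert (Sne : exists w, S w).
  { destruct Htop as [w [w' [H1 [H2 H3]]]]. exists w. split; eauto. }
  assert (G : forall i, exists m, (forall w, S w -> m <= w i) /\
                 forall k, (forall w, S w -> k <= w i) -> k <= m).
  { intros i. set (E := fun y => exists w, S w /\ y = w i).
    destruct (Glb_Rbar_correct E) as [A B].
    destruct Sne as [w0 S0].
    destruct (Glb_Rbar E) as [m| |].
    - exists m. split.
      + intros w Sw. apply (A (w i)). now exists w.
      + intros k Hk. apply (B (Finite k)). intros y [w [Sw ->]]. now apply Hk.
    - exfalso. now apply (A (w0 i)); exists w0.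
    - exfalso. apply (B (Finite 0)). intros y [w [[Xw _] ->]]. now apply Hpos. }
  destruct (choice _ G) as [m Hm].
  assert (Xm : X m).
  { apply (Hinf S); auto.
    - now intros w [Xw _].
    - intros w i Sw. now apply Hm.
    - intros i k Hk. now apply Hm. }
  destruct (Htot m Xm) as [m' [Tm Xm']].
  assert (A : forall i, m' i <= m i).
  { intros i. apply Hm. intros w [Xw [w' [Tw Hw]]].
    apply Rle_trans with (w' i); [|apply Hw].
    apply (Hmon m w m' w'); auto. intros j. apply Hm. split; eauto. }
  assert (S' : S m').
  { split; [exact Xm'|]. destruct (Htot m' Xm') as [m'' [Tm' _]].
    exists m''. split; [exact Tm'|]. now apply (Hmon m' m m'' m'). }
  assert (E : m' = m).
  { apply functional_extensionality. intros i.
    apply Rle_antisym; [apply A|]. now apply Hm. }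
  exists m. split; [exact Xm|]. now rewrite E in Tm.
Qed.

(** Writing the damping coefficient as mu (mu + c) makes the characteristic roots
    - mu and mu + c, without square roots, so that y'' - c y' - mu (mu + c) y = - g
    is solved by two successive first-order equations. *)
Lemma linear_bvp (a c mu : R) (g : R -> R) :
  0 < a -> 0 < mu -> 0 <= c -> (forall t, continuous g t) ->
  exists y y1, y (- a) = 0 /\ y a = 1 /\
    forall t, is_derive y t (y1 t) /\
      is_derive y1 t (c * y1 t - (g t - mu * (mu + c) * y t)).
Proof.
  intros Ha Hmu Hc Hg. set (nu := mu + c).
  assert (De : forall k t, is_derive (fun t => exp (k * t)) t (k * exp (k * t))).
  { intros k t. auto_derive; [trivial|ring]. }
  assert (FO : forall k (f : R -> R), (forall t, continuous f t) ->
    exists v : R -> R, forall t, is_derive v t (k * v t + f t)).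
  { intros k f Hf.
    set (q := fun s => exp (- k * s) * f s).
    assert (Cq : forall t, continuous q t).
    { intros t. apply: continuous_mult; [|apply Hf].
      eapply derive_continuous. apply De. }
    exists (fun t => exp (k * t) * RInt q 0 t). intros t.
    replace (k * _ + f t) with
      (k * exp (k * t) * RInt q 0 t + exp (k * t) * q t).
    2:{ unfold q. rewrite -!Rmult_assoc -exp_plus.
        replace (k * t + - k * t) with 0 by ring. rewrite exp_0. ring. }
    apply: (is_derive_mult (fun t => exp (k * t)) (fun t => RInt q 0 t)).
    - apply De.
    - apply: is_derive_RInt; [|apply Cq].
      apply filter_forall. intros s. apply: RInt_correct.
      apply: ex_RInt_continuous. intros z _. apply Cq.
    - intros; apply Rmult_comm. }
  destruct (FO (- mu) (fun t => - g t)) as [p Hp].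
  { intros t. apply: continuous_opp. apply Hg. }
  destruct (FO nu p) as [v Hv].
  { intros t. eapply derive_continuous. apply Hp. }
  set (y0 := fun al be t => v t + al * exp (- mu * t) + be * exp (nu * t)).
  set (y1 := fun al be t => nu * v t + p t + al * (- mu * exp (- mu * t))
                            + be * (nu * exp (nu * t))).
  assert (D : forall al be t, is_derive (y0 al be) t (y1 al be t) /\
    is_derive (y1 al be) t
      (c * y1 al be t - (g t - mu * nu * y0 al be t))).
  { intros al be t. split.
    - unfold y0, y1. apply: is_derive_plus; [apply: is_derive_plus|].
      + apply Hv.
      + apply: is_derive_scal. apply De.
      + apply: is_derive_scal. apply De.
    - unfold y0, y1.
      replace (_ - _) with
       (nu * (nu * v t + p t) + (- mu * p t + - g t)
        + al * (- mu * (- mu * exp (- mu * t)))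
        + be * (nu * (nu * exp (nu * t)))) by (unfold nu; ring).
      apply: is_derive_plus; [apply: is_derive_plus; [apply: is_derive_plus|]|].
      + apply: is_derive_scal. apply Hv.
      + apply Hp.
      + do 2 apply: is_derive_scal. apply De.
      + do 2 apply: is_derive_scal. apply De. }
  (* The two boundary values determine the coefficients of the homogeneous
     solutions because mu and nu are positive. *)
  set (E1 := exp (mu * a)). set (E2 := exp (nu * a)).
  assert (H1 : 1 < E1) by (unfold E1; rewrite -exp_0; apply exp_increasing; nra).
  assert (H2 : 1 < E2).
  { unfold E2; rewrite -exp_0; apply exp_increasing; unfold nu; nra. }
  assert (I1 : exp (- mu * a) = / E1).
  { unfold E1. rewrite -exp_Ropp. f_equal. ring. }
  assert (I2 : exp (nu * - a) = / E2).
  { unfold E2. rewrite -exp_Ropp. f_equal. ring. }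
  assert (I3 : exp (- mu * - a) = E1) by (unfold E1; f_equal; ring).
  assert (Hdet : E1 * E2 - / E1 * / E2 > 0).
  { assert (/ E1 < 1) by (rewrite -Rinv_1; apply Rinv_lt_contravar; lra).
    assert (/ E2 < 1) by (rewrite -Rinv_1; apply Rinv_lt_contravar; lra).
    assert (0 < / E1) by (apply Rinv_0_lt_compat; lra).
    assert (0 < / E2) by (apply Rinv_0_lt_compat; lra). nra. }
  set (al := (- v (- a) * E2 - (1 - v a) * / E2) / (E1 * E2 - / E1 * / E2)).
  set (be := (E1 * (1 - v a) + / E1 * v (- a)) / (E1 * E2 - / E1 * / E2)).
  exists (y0 al be), (y1 al be). split; [|split].
  - unfold y0. rewrite I3 I2. unfold al, be.
    remember (/ E1) as F1. remember (/ E2) as F2. field. lra.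
  - unfold y0. rewrite I1. fold E2. unfold al, be.
    remember (/ E1) as F1. remember (/ E2) as F2. field. lra.
  - intros t. apply D.
Qed.

(** On a unit interval some slope is at most 1, and x' - c x changes by at most M
    over that interval.  The bound does not depend on the length of [l, u]. *)
Lemma derive_bound (l u c M : R) (x x1 g : R -> R) :
  l + 1 <= u -> 0 <= c ->
  (forall t, l <= t <= u -> 0 <= x t <= 1) ->
  (forall t, is_derive x t (x1 t)) ->
  (forall t, is_derive x1 t (c * x1 t - g t)) ->
  (forall t, l <= t <= u -> Rabs (g t) <= M) ->
  forall t, l <= t <= u -> Rabs (x1 t) <= 1 + M + c.
Proof.
  intros Hlu Hc Hx D1 D2 Hg t Ht.
  set (s := Rmin t (u - 1)).
  assert (Hs : l <= s <= t /\ t <= s + 1 /\ s + 1 <= u).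
  { unfold s, Rmin. destruct (Rle_dec t (u - 1)); lra. }
  destruct (mean_value x x1 s (s + 1)) as [y [Hy E]]; try lra.
  { intros; apply D1. }
  { intros; eapply derive_continuous; apply D1. }
  assert (B : Rabs (x1 y) <= 1).
  { assert (A1 := Hx s ltac:(lra)). assert (A2 := Hx (s + 1) ltac:(lra)).
    apply Rabs_le. lra. }
  set (w := fun t => x1 t - c * x t).
  assert (Dw : forall t, is_derive w t (- g t)).
  { intros q. unfold w. replace (- g q) with ((c * x1 q - g q) - c * x1 q) by ring.
    apply: is_derive_minus; [apply D2|]. apply: is_derive_scal. apply D1. }
  assert (Cw : forall t, continuous w t).
  { intros q. eapply derive_continuous. apply Dw. }
  assert (Hw : Rabs (w t - w y) <= M).
  { destruct (Rtotal_order t y) as [N|[->|N]].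
    - destruct (mean_value w (fun t => - g t) t y) as [q [Hq Eq]]; auto.
      assert (A := Hg q ltac:(lra)).
      rewrite Rabs_minus_sym Eq Rabs_mult Rabs_Ropp (Rabs_pos_eq (y - t)); [|lra].
      pose proof (Rabs_pos (g q)). nra.
    - rewrite Rminus_diag Rabs_R0. apply Rle_trans with (Rabs (g y)).
      apply Rabs_pos. apply Hg. lra.
    - destruct (mean_value w (fun t => - g t) y t) as [q [Hq Eq]]; auto.
      assert (A := Hg q ltac:(lra)).
      rewrite Eq Rabs_mult Rabs_Ropp (Rabs_pos_eq (t - y)); [|lra].
      pose proof (Rabs_pos (g q)). nra. }
  assert (A1 := Hx t Ht). assert (A2 := Hx y ltac:(lra)).
  apply Rabs_le_between in Hw. apply Rabs_le_between in B.
  unfold w in Hw. apply Rabs_le.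
  assert (- c <= c * x t - c * x y <= c) by nra. lra.
Qed.

Definition profile (a : R) (x : R -> R) : Prop :=
  (forall t, 0 <= x t <= 1) /\ (forall t, t <= - a -> x t = 0) /\
  (forall t, a <= t -> x t = 1).

(** The solution of the linear problem is extended by its boundary values; it is
    the composition of a differentiable function with the projection onto [-a, a],
    which makes it globally Lipschitz.  The Lipschitz constant is independent of a. *)
Lemma relaxed_profile (a c C mu : R) (g : R -> R) :
  1 / 2 <= a -> 0 < mu -> 0 <= c <= C ->
  (forall t, continuous g t) -> (forall t, 0 <= g t <= mu * (mu + c)) ->
  exists x, profile a x /\ lip (1 + mu * (mu + C) + C) x /\
    ode_on (- a) a c x (fun t => g t - mu * (mu + c) * x t).
Proof.
  intros Ha Hmu Hc Hg Hb.
  destruct (linear_bvp a c mu g) as [y [y1 [Yl [Yr D]]]]; try lra; auto.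
  set (K := mu * (mu + c)) in *.
  assert (D1 : forall t, is_derive y t (y1 t)) by (intros t; apply (proj1 (D t))).
  assert (D2 : forall t, is_derive y1 t (c * y1 t - (g t - K * y t)))
    by (intros t; apply (proj2 (D t))).
  clear D.
  assert (HK : 0 < K) by (unfold K; nra).
  assert (Cy : forall t, continuous y t).
  { intros t. eapply derive_continuous. apply D1. }
  assert (Y0 : forall t, - a <= t <= a -> 0 <= y t).
  { apply (min_principle (- a) a y y1 (fun t => c * y1 t - (g t - K * y t)));
      auto; try lra.
    intros t Ht Hn Hz. rewrite Hz. assert (A := Hb t). nra. }
  assert (Y1 : forall t, - a <= t <= a -> y t <= 1).
  { intros t Ht.
    enough (0 <= 1 - y t) by lra. revert t Ht.
    apply (min_principle (- a) a (fun t => 1 - y t) (fun t => - y1 t)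
            (fun t => - (c * y1 t - (g t - K * y t)))); try lra.
    - intros t _. split.
      + replace (- y1 t) with (0 - y1 t) by ring.
        apply: is_derive_minus; [apply: is_derive_const|apply D1].
      + apply: is_derive_opp. apply D2.
    - intros t _. apply: continuous_minus; [apply: continuous_const|apply Cy].
    - intros t Ht Hn Hz. assert (A := Hb t). replace (y1 t) with 0 by lra. nra. }
  assert (B1 : forall t, - a <= t <= a -> Rabs (y1 t) <= 1 + K + c).
  { apply (derive_bound (- a) a c K y y1 (fun t => g t - K * y t));
      try lra; auto.
    intros t Ht. assert (A := Hb t). assert (0 <= K * y t <= K).
      { split; [apply Rmult_le_pos; [lra|now apply Y0]|].
        assert (A' := Y1 t Ht). nra. }
      apply Rabs_le. lra. }
  set (cl := fun t => Rmax (- a) (Rmin a t)).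
  assert (cl_l : forall t, t <= - a -> cl t = - a).
  { intros t Ht. unfold cl. rewrite Rmin_right; [|lra]. apply Rmax_left. lra. }
  assert (cl_r : forall t, a <= t -> cl t = a).
  { intros t Ht. unfold cl. rewrite Rmin_left; [|lra]. apply Rmax_right. lra. }
  assert (cl_m : forall t, - a <= t <= a -> cl t = t).
  { intros t Ht. unfold cl. rewrite Rmin_right; [|lra]. apply Rmax_right. lra. }
  assert (Hcl : forall t, - a <= cl t <= a).
  { intros t. destruct (Rle_lt_dec t (- a)); [rewrite cl_l; lra|].
    destruct (Rle_lt_dec a t); [rewrite cl_r; lra|rewrite cl_m; lra]. }
  exists (fun t => y (cl t)). split; [|split].
  - split; [|split].
    + intros t. split; [apply Y0|apply Y1]; apply Hcl.
    + now intros t Ht; rewrite cl_l.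
    + now intros t Ht; rewrite cl_r.
  - assert (W : forall s t, s <= t ->
      Rabs (y (cl s) - y (cl t)) <= (1 + K + c) * Rabs (s - t)).
    { intros s t Hst.
      assert (0 <= cl t - cl s <= t - s).
      { pose proof (Hcl s). pose proof (Hcl t).
        destruct (Rle_lt_dec s (- a)).
        - rewrite (cl_l s); [|lra]. destruct (Rle_lt_dec t (- a)); [rewrite (cl_l t); lra|].
          destruct (Rle_lt_dec a t); [rewrite (cl_r t); lra|rewrite (cl_m t); lra].
        - destruct (Rle_lt_dec a s); [rewrite (cl_r s) ?(cl_r t); lra|].
          rewrite (cl_m s); [|lra].
          destruct (Rle_lt_dec a t); [rewrite (cl_r t); lra|rewrite (cl_m t); lra]. }
      destruct (Req_dec (cl s) (cl t)) as [->|N].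
      - rewrite Rminus_diag Rabs_R0. apply Rmult_le_pos; [lra|apply Rabs_pos].
      - destruct (mean_value y y1 (cl s) (cl t)) as [q [Hq Eq]]; try lra.
        { intros; apply D1. } { intros; apply Cy. }
        rewrite Rabs_minus_sym Eq Rabs_mult (Rabs_minus_sym s).
        apply Rmult_le_compat; try apply Rabs_pos.
        + apply B1. pose proof (Hcl s). pose proof (Hcl t). lra.
        + rewrite !Rabs_pos_eq; lra. }
    assert (HL : 1 + K + c <= 1 + mu * (mu + C) + C) by (unfold K; nra).
    intros s t. apply Rle_trans with ((1 + K + c) * Rabs (s - t)).
    + destruct (Rle_lt_dec s t) as [H|H]; [now apply W|].
      rewrite Rabs_minus_sym (Rabs_minus_sym s). apply W. lra.
    + apply Rmult_le_compat_r; [apply Rabs_pos|exact HL].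
  - apply ode_on_of_derives with y1.
    + intros t Ht. apply is_derive_ext_loc with y; [|apply D1].
      apply: filter_imp (locally_between _ _ _ Ht) => s Hs. rewrite cl_m; [reflexivity|lra].
    + intros t Ht. rewrite cl_m; [|lra]. apply D2.
Qed.

Lemma relaxed_profile_le (a c K : R) (x1 x2 g1 g2 : R -> R) :
  0 < a -> 0 < K -> profile a x1 -> profile a x2 ->
  (forall t, continuous x1 t) -> (forall t, continuous x2 t) ->
  ode_on (- a) a c x1 (fun t => g1 t - K * x1 t) ->
  ode_on (- a) a c x2 (fun t => g2 t - K * x2 t) ->
  (forall t, g1 t <= g2 t) -> forall t, x1 t <= x2 t.
Proof.
  intros Ha HK [_ [L1 R1]] [_ [L2 R2]] C1 C2 O1 O2 Hg t.
  destruct (Rle_lt_dec t (- a)) as [H|H]; [rewrite L1 ?L2; lra|].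
  destruct (Rle_lt_dec a t) as [H'|H']; [rewrite R1 ?R2; lra|].
  assert (O := ode_on_minus _ _ _ _ _ _ _ O2 O1).
  enough (0 <= x2 t - x1 t) by lra.
  assert (Ht : - a <= t <= a) by lra. clear H H'. revert t Ht.
  apply (min_principle (- a) a (fun t => x2 t - x1 t) _ _ ltac:(lra)
     (fun t Ht => conj (ode_on_derive _ _ _ _ _ O t Ht) (proj2 (O t Ht)))).
  - intros t _. apply: continuous_minus; auto.
  - rewrite L1 ?L2; lra.
  - rewrite R1 ?R2; lra.
  - intros t Ht Hn Hz. rewrite Hz. specialize (Hg t). nra.
Qed.

(** * Fronts on a bounded interval: existence *)

Definition react_u (r x y : R) : R := x * (1 - r - x + r * y).
Definition react_v (b e x y : R) : R := (b * x - e * y) * (1 - y).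

(** Adding K x makes the reaction nondecreasing in both arguments. *)
Lemma react_u_cooperative (r K x1 x2 y1 y2 : R) :
  0 < r -> 1 + r <= K -> 0 <= x1 <= x2 -> x2 <= 1 -> 0 <= y1 <= y2 ->
  - K * (x2 - x1) <= react_u r x2 y2 - react_u r x1 y1.
Proof.
  intros Hr HK Hx Hx' Hy. unfold react_u.
  assert (0 <= r * (x2 * y2 - x1 * y1)).
  { apply Rmult_le_pos; [lra|]. nra. }
  assert (0 <= (x2 - x1) * (K + 1 - r - (x1 + x2))).
  { apply Rmult_le_pos; lra. }
  nra.
Qed.

Lemma react_v_cooperative (b e K x1 x2 y1 y2 : R) :
  0 < b -> 0 < e -> b + e <= K -> x1 <= x2 -> 0 <= x1 <= 1 ->
  0 <= y1 <= y2 -> y2 <= 1 ->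
  - K * (y2 - y1) <= react_v b e x2 y2 - react_v b e x1 y1.
Proof.
  intros Hb He HK Hx Hx1 Hy Hy1. unfold react_v.
  assert (0 <= b * ((x2 - x1) * (1 - y2))).
  { apply Rmult_le_pos; [lra|]. apply Rmult_le_pos; lra. }
  assert (0 <= (y2 - y1) * (K - e - b * x1 + e * (y1 + y2))).
  { apply Rmult_le_pos; [lra|]. nra. }
  nra.
Qed.

Lemma react_u_continuous (r : R) (f g : R -> R) (t : R) :
  continuous f t -> continuous g t -> continuous (fun t => react_u r (f t) (g t)) t.
Proof.
  intros Cf Cg. apply: continuous_mult; [exact Cf|]. apply: continuous_plus.
  - apply: continuous_minus; [apply: continuous_const|exact Cf].
  - apply: continuous_scal_r. exact Cg.
Qed.

Lemma react_v_continuous (b e : R) (f g : R -> R) (t : R) :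
  continuous f t -> continuous g t -> continuous (fun t => react_v b e (f t) (g t)) t.
Proof.
  intros Cf Cg. apply: continuous_mult.
  - apply: continuous_minus; apply: continuous_scal_r; assumption.
  - apply: continuous_minus; [apply: continuous_const|exact Cg].
Qed.

(** The root mu in the linear problem: mu (mu + c) >= mu is at least each of the
    constants K required by [react_u_cooperative] and [react_v_cooperative]. *)
Definition rate (b r : R) : R := 1 + r + b.
(** A Lipschitz constant valid for all truncated fronts with speeds in [0, 3 + b]. *)
Definition slope (b r : R) : R :=
  1 + rate b r * (rate b r + (3 + b)) + (3 + b).

Definition system_on (l u b h r e c : R) (phi psi : R -> R) : Prop :=
  ode_on l u c phi (fun t => react_u r (phi t) (psi (t - c * h))) /\
  ode_on l u c psi (fun t => react_v b e (phi t) (psi t)).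

(** The Lipschitz bounds are part of the notion because they are what survives
    the passage to the limit of long intervals. *)
Definition truncated_front (a b h r e c : R) (phi psi : R -> R) : Prop :=
  profile a phi /\ profile a psi /\
  lip (slope b r) phi /\ lip (slope b r) psi /\
  system_on (- a) a b h r e c phi psi.

(** A truncated front is a fixed point of the map sending (phi, psi) to the
    profiles that solve the damped linear equations with the sources f + K phi and
    g + K psi.  The map is monotone, and it sends pairs with values in [0, 1] to
    Lipschitz pairs with values in [0, 1]. *)
Lemma truncated_front_exists (a b h r e c : R) :
  1 / 2 <= a -> 0 < b -> 1 < r -> 0 < e <= 1 -> 0 <= c <= 3 + b ->
  exists phi psi, truncated_front a b h r e c phi psi.
Proof.
  intros Ha Hb Hr He Hc.
  set (mu := rate b r). set (K := mu * (mu + c)). set (L := slope b r).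
  assert (Hmu : 1 + r + b <= mu) by (unfold mu, rate; lra).
  assert (HK : mu <= K) by (unfold K; nra).
  set (gF := fun (w : bool * R -> R) t =>
    react_u r (w (true, t)) (w (false, t - c * h)) + K * w (true, t)).
  set (gG := fun (w : bool * R -> R) t =>
    react_v b e (w (true, t)) (w (false, t)) + K * w (false, t)).
  (* A pair of functions is encoded as one function on bool * R, with [true] for
     phi and [false] for psi. *)
  set (X := fun w : bool * R -> R => (forall i, 0 <= w i <= 1) /\
    forall k, lip L (fun t => w (k, t))).
  set (T := fun w x : bool * R -> R =>
    (forall k, profile a (fun t => x (k, t))) /\
    (forall k, lip L (fun t => x (k, t))) /\
    ode_on (- a) a c (fun t => x (true, t)) (fun t => gF w t - K * x (true, t)) /\
    ode_on (- a) a c (fun t => x (false, t)) (fun t => gG w t - K * x (false, t))).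
  assert (gF_le : forall w1 w2, X w1 -> X w2 -> (forall i, w1 i <= w2 i) ->
    forall t, gF w1 t <= gF w2 t).
  { intros w1 w2 [B1 _] [B2 _] H t. unfold gF.
    assert (A := react_u_cooperative r K (w1 (true, t)) (w2 (true, t))
      (w1 (false, t - c * h)) (w2 (false, t - c * h))).
    pose proof (B1 (true, t)). pose proof (B2 (true, t)). pose proof (H (true, t)).
    pose proof (B1 (false, t - c * h)). pose proof (H (false, t - c * h)).
    lra. }
  assert (gG_le : forall w1 w2, X w1 -> X w2 -> (forall i, w1 i <= w2 i) ->
    forall t, gG w1 t <= gG w2 t).
  { intros w1 w2 [B1 _] [B2 _] H t. unfold gG.
    assert (A := react_v_cooperative b e K (w1 (true, t)) (w2 (true, t))
      (w1 (false, t)) (w2 (false, t))).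
    pose proof (B1 (true, t)). pose proof (H (true, t)). pose proof (B2 (false, t)).
    pose proof (B1 (false, t)). pose proof (H (false, t)).
    lra. }
  assert (Xk : forall k, 0 <= k <= 1 -> X (fun _ => k)).
  { intros k Hk. split; [now intros|]. intros i s t.
    rewrite Rminus_diag Rabs_R0. apply Rmult_le_pos; [|apply Rabs_pos].
    unfold L, slope. fold mu. nra. }
  assert (gF_b : forall w, X w -> forall t, 0 <= gF w t <= K).
  { intros w Xw t. split.
    - apply Rle_trans with (gF (fun _ => 0) t).
      unfold gF, react_u; lra. apply gF_le; auto; [apply Xk; lra|]. intros i. apply Xw.
    - apply Rle_trans with (gF (fun _ => 1) t).
      apply gF_le; auto; [apply Xk; lra|]. intros i. apply Xw. unfold gF, react_u; lra. }
  assert (gG_b : forall w, X w -> forall t, 0 <= gG w t <= K).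
  { intros w Xw t. split.
    - apply Rle_trans with (gG (fun _ => 0) t).
      unfold gG, react_v; lra. apply gG_le; auto; [apply Xk; lra|]. intros i. apply Xw.
    - apply Rle_trans with (gG (fun _ => 1) t).
      apply gG_le; auto; [apply Xk; lra|]. intros i. apply Xw. unfold gG, react_v; lra. }
  assert (Cw : forall w, X w -> forall k s t, continuous (fun t => w (k, t - s)) t).
  { intros w Xw k s t. apply (continuous_comp (fun t => t - s) (fun t => w (k, t))).
    - apply: continuous_minus; [apply: continuous_id|apply: continuous_const].
    - eapply lip_continuous. apply Xw. }
  assert (Cw0 : forall w, X w -> forall k t, continuous (fun t => w (k, t)) t).
  { intros w Xw k t. eapply lip_continuous. apply Xw. }
  assert (Tot : forall w, X w -> exists x, T w x /\ X x).
  { intros w Xw.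
    destruct (relaxed_profile a c (3 + b) mu (gF w)) as [x [P1 [L1 O1]]]; try lra.
    { intros t. unfold gF. apply: continuous_plus.
      - apply react_u_continuous; auto.
      - apply: continuous_scal_r. auto. }
    { now apply gF_b. }
    destruct (relaxed_profile a c (3 + b) mu (gG w)) as [y [P2 [L2 O2]]]; try lra.
    { intros t. unfold gG. apply: continuous_plus.
      - apply react_v_continuous; auto.
      - apply: continuous_scal_r. auto. }
    { now apply gG_b. }
    exists (fun i => if fst i then x (snd i) else y (snd i)). split.
    - split; [now intros []|]. split; [now intros []|]. now split.
    - split; [|now intros []]. intros [[] t]; simpl; [apply P1|apply P2]. }
  destruct (tarski_least_fixed_point (bool * R) X T) as [w [Xw [Pw [Lw [O1 O2]]]]].
  - intros w i Xw. apply Xw.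
  - intros S m [w0 S0] SX Hl Hg. split.
    + intros i. split.
      * apply Hg. intros w Sw. now apply SX.
      * apply Rle_trans with (w0 i); [now apply Hl|]. now apply SX.
    + assert (H : forall k s t, m (k, s) - L * Rabs (s - t) <= m (k, t)).
      { intros k s t. apply Hg. intros w Sw.
        assert (A := proj2 (SX w Sw) k s t). apply Rabs_le_between in A.
        assert (B := Hl w (k, s) Sw). lra. }
      intros k s t. apply Rabs_le. assert (A := H k s t). assert (B := H k t s).
      rewrite (Rabs_minus_sym t) in B. lra.
  - exact Tot.
  - intros w1 w2 x1 x2 X1 X2 [P1 [L1 [O1 O1']]] [P2 [L2 [O2 O2']]] Hw [[] t].
    + apply (relaxed_profile_le a c K (fun t => x1 (true, t)) (fun t => x2 (true, t))
       (gF w1) (gF w2)); auto; try lra; intros; eapply lip_continuous; eauto.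
    + apply (relaxed_profile_le a c K (fun t => x1 (false, t)) (fun t => x2 (false, t))
       (gG w1) (gG w2)); auto; try lra; intros; eapply lip_continuous; eauto.
  - destruct (Tot (fun _ => 1)) as [x [Tx Xx]]; [apply Xk; lra|].
    exists (fun _ => 1), x. split; [apply Xk; lra|]. split; [exact Tx|]. intros i. apply Xx.
  - exists (fun t => w (true, t)), (fun t => w (false, t)).
    split; [exact (Pw true)|]. split; [exact (Pw false)|].
    split; [exact (Lw true)|]. split; [exact (Lw false)|]. split.
    + apply (ode_on_ext _ _ _ _ _ _ O1). intros; unfold gF; ring.
    + apply (ode_on_ext _ _ _ _ _ _ O2). intros; unfold gG; ring.
Qed.

(** * Fronts on a bounded interval: sliding *)

(** The difference of the first components satisfies d'' - c d' - K d <= 0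
    whatever the ordered second components are, and conversely; so the scalar strong
    maximum principle applies to each component separately, and the delay is harmless. *)
Lemma ordered_solutions_strict (l u b h r e c : R) (phi1 psi1 phi2 psi2 : R -> R) :
  0 < b -> 1 < r -> 0 < e <= 1 -> 0 <= c ->
  system_on l u b h r e c phi1 psi1 -> system_on l u b h r e c phi2 psi2 ->
  (forall t, 0 <= phi2 t <= phi1 t /\ phi1 t <= 1 /\
             0 <= psi2 t <= psi1 t /\ psi1 t <= 1) ->
  (forall t, continuous phi1 t /\ continuous psi1 t /\
             continuous phi2 t /\ continuous psi2 t) ->
  (phi2 l < phi1 l \/ phi2 u < phi1 u -> forall t, l < t < u -> phi2 t < phi1 t) /\
  (psi2 l < psi1 l \/ psi2 u < psi1 u -> forall t, l < t < u -> psi2 t < psi1 t).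
Proof.
  intros Hb Hr He Hc [O1 O1'] [O2 O2'] Ho Hco. split; intros Hs t Ht.
  - destruct (Rlt_le_dec (phi2 t) (phi1 t)) as [H|H]; [exact H|exfalso].
    assert (Z := strong_max_principle l u c (1 + r) _ _ t Hc ltac:(lra)
      (ode_on_minus _ _ _ _ _ _ _ O1 O2)).
    assert (E : forall s, l <= s <= u -> phi1 s - phi2 s = 0).
    { apply Z; auto.
      - intros s Hs'. pose proof (Ho s). pose proof (Ho (s - c * h)).
        apply react_u_cooperative; lra.
      - intros s _. pose proof (Ho s). lra.
      - intros s _. destruct (Hco s) as [? [? [? ?]]].
        apply: continuous_minus; assumption.
      - pose proof (Ho t). lra. }
    assert (A := E l ltac:(lra)). assert (B := E u ltac:(lra)). lra.
  - destruct (Rlt_le_dec (psi2 t) (psi1 t)) as [H|H]; [exact H|exfalso].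
    assert (Z := strong_max_principle l u c (b + e) _ _ t Hc ltac:(lra)
      (ode_on_minus _ _ _ _ _ _ _ O1' O2')).
    assert (E : forall s, l <= s <= u -> psi1 s - psi2 s = 0).
    { apply Z; auto.
      - intros s Hs'. pose proof (Ho s).
        apply react_v_cooperative; lra.
      - intros s _. pose proof (Ho s). lra.
      - intros s _. destruct (Hco s) as [? [? [? ?]]].
        apply: continuous_minus; assumption.
      - pose proof (Ho t). lra. }
    assert (A := E l ltac:(lra)). assert (B := E u ltac:(lra)). lra.
Qed.

Lemma system_on_const (l u b h r e c k : R) :
  react_u r k k = 0 -> react_v b e k k = 0 ->
  system_on l u b h r e c (fun _ => k) (fun _ => k).
Proof.
  intros HF HG.
  split; (eapply ode_on_ext; [apply ode_on_const|]); intros; simpl; congruence.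
Qed.

Lemma system_on_shift (l u b h r e c s : R) (phi psi : R -> R) :
  system_on l u b h r e c phi psi ->
  system_on (l - s) (u - s) b h r e c (fun t => phi (t + s)) (fun t => psi (t + s)).
Proof.
  intros [O1 O2]. split.
  - apply (ode_on_ext _ _ _ _ _ _ (ode_on_shift _ _ _ s _ _ O1)).
    intros t _. f_equal. f_equal. ring.
  - apply (ode_on_ext _ _ _ _ _ _ (ode_on_shift _ _ _ s _ _ O2)).
    intros t _. reflexivity.
Qed.

(** Comparison with the constant solutions (0,0) and (1,1). *)
Lemma truncated_front_inside (a b h r e c : R) (phi psi : R -> R) :
  0 < a -> 0 < b -> 1 < r -> 0 < e <= 1 -> 0 <= c ->
  truncated_front a b h r e c phi psi ->
  forall t, - a < t < a -> 0 < phi t < 1 /\ 0 < psi t < 1.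
Proof.
  intros Ha Hb Hr He Hc [P1 [P2 [L1 [L2 S]]]] t Ht.
  assert (C1 := lip_continuous _ _ L1). assert (C2 := lip_continuous _ _ L2).
  assert (B1 := proj1 P1). assert (B2 := proj1 P2).
  assert (C : forall k t : R, continuous (fun _ : R => k) t)
    by (intros; apply: continuous_const).
  destruct (ordered_solutions_strict (- a) a b h r e c phi psi (fun _ => 0) (fun _ => 0))
    as [A1 A2]; auto.
  { apply system_on_const; unfold react_u, react_v; ring. }
  { intros s. pose proof (B1 s). pose proof (B2 s). lra. }
  destruct (ordered_solutions_strict (- a) a b h r e c (fun _ => 1) (fun _ => 1) phi psi)
    as [A3 A4]; auto.
  { apply system_on_const; unfold react_u, react_v; ring. }
  { intros s. pose proof (B1 s). pose proof (B2 s). lra. }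
  assert (phi a = 1) by (apply P1; lra). assert (psi a = 1) by (apply P2; lra).
  assert (phi (- a) = 0) by (apply P1; lra). assert (psi (- a) = 0) by (apply P2; lra).
  repeat split; [apply A1|apply A3|apply A2|apply A4]; lra.
Qed.

Lemma continuous_pos_lower_bound (l u : R) (f : R -> R) :
  l <= u -> (forall t, continuous f t) -> (forall t, l <= t <= u -> 0 < f t) ->
  exists m, 0 < m /\ forall t, l <= t <= u -> m <= f t.
Proof.
  intros Hlu Hc Hp. destruct (continuity_ab_min f l u) as [m [Hm Hmi]]; [lra| |].
  - intros y _. apply continuity_pt_filterlim, Hc.
  - exists (f m). split; auto.
Qed.

(** If y stays strictly below the shifted x where both are inside their transition
    zones, the shift can be decreased a little: elsewhere one of the two profiles is
    constant and the order is automatic. *)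
Lemma shift_below_opens (a L s0 : R) (x y : R -> R) :
  0 <= s0 <= 2 * a -> 0 < L -> profile a x -> profile a y -> lip L x -> lip L y ->
  (forall t, - a <= t <= a - s0 -> y t < x (t + s0)) ->
  exists eta, 0 < eta /\
    forall s, s0 - eta < s <= s0 -> forall t, y t <= x (t + s).
Proof.
  intros Hs0 HL Px Py Lx Ly Hst.
  destruct (continuous_pos_lower_bound (- a) (a - s0) (fun t => x (t + s0) - y t)) as [m [Hm Hg]].
  - lra.
  - intros t. apply: continuous_minus; [|eapply lip_continuous; eauto].
    apply (continuous_comp (fun t => t + s0) x); [|eapply lip_continuous; eauto].
    apply: continuous_plus; [apply: continuous_id|apply: continuous_const].
  - intros t Ht. specialize (Hst t Ht). lra.
  - exists (m / (2 * L)). split; [apply Rdiv_lt_0_compat; lra|].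
    intros s Hs t.
    assert (HLe : L * (m / (2 * L)) = m / 2) by (field; lra).
    assert (HLs : L * (s0 - s) <= m / 2) by (rewrite -HLe; apply Rmult_le_compat_l; lra).
    assert (Bx := proj1 Px). assert (By := proj1 Py).
    destruct (Rle_lt_dec t (- a)) as [H1|H1].
    { rewrite (proj1 (proj2 Py)); [apply Bx|exact H1]. }
    destruct (Rle_lt_dec (a - s) t) as [H2|H2].
    { rewrite (proj2 (proj2 Px)); [apply By|lra]. }
    assert (Lxs := Lx (t + s0) (t + s)).
    replace (t + s0 - (t + s)) with (s0 - s) in Lxs by ring.
    rewrite (Rabs_pos_eq (s0 - s)) in Lxs; [|lra].
    apply Rabs_le_between in Lxs.
    destruct (Rle_lt_dec t (a - s0)) as [H3|H3].
    + assert (A := Hg t ltac:(lra)). lra.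
    + assert (A := Hg (a - s0) ltac:(lra)).
      replace (a - s0 + s0) with a in A by ring.
      rewrite (proj2 (proj2 Px) a) in A; [|lra].
      rewrite (proj2 (proj2 Px) (t + s0)) in Lxs; [|lra].
      assert (Lys := Ly t (a - s0)).
      assert (L * Rabs (t - (a - s0)) <= L * (s0 - s)).
      { apply Rmult_le_compat_l; [lra|]. rewrite Rabs_pos_eq; lra. }
      apply Rabs_le_between in Lys. lra.
Qed.

Lemma slope_pos (b r : R) : 0 < b -> 1 < r -> 0 < slope b r.
Proof. intros. unfold slope, rate. nra. Qed.

(** Shifted by 2 a or more, the first front is above the second.  If some positive
    shift were not good, the supremum s0 of the bad shifts would be a positive good
    shift, where the fronts are strictly ordered on [-a, a - s0] since they are so at
    its ends; by [shift_below_opens] slightly smaller shifts are good as well. *)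
Lemma sliding (a b h r e c : R) (phi1 psi1 phi2 psi2 : R -> R) :
  0 < a -> 0 < b -> 1 < r -> 0 < e <= 1 -> 0 <= c ->
  truncated_front a b h r e c phi1 psi1 -> truncated_front a b h r e c phi2 psi2 ->
  forall s, 0 < s -> forall t, phi2 t <= phi1 (t + s) /\ psi2 t <= psi1 (t + s).
Proof.
  intros Ha Hb Hr He Hc T1 T2.
  assert (I1 := truncated_front_inside a b h r e c _ _ Ha Hb Hr He Hc T1).
  assert (I2 := truncated_front_inside a b h r e c _ _ Ha Hb Hr He Hc T2).
  destruct T1 as [P1 [Q1 [L1 [M1 S1]]]]. destruct T2 as [P2 [Q2 [L2 [M2 S2]]]].
  assert (C1 := lip_continuous _ _ L1). assert (D1 := lip_continuous _ _ M1).
  assert (C2 := lip_continuous _ _ L2). assert (D2 := lip_continuous _ _ M2).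
  assert (HL := slope_pos b r Hb Hr).
  set (good := fun s => forall t, phi2 t <= phi1 (t + s) /\ psi2 t <= psi1 (t + s)).
  intros s1 Hs1. change (good s1). apply NNPP. intros Hbad.
  assert (Hfar : forall s, 2 * a <= s -> good s).
  { intros s Hs t. destruct (Rle_lt_dec t (- a)) as [H|H].
    - rewrite (proj1 (proj2 P2) t H) (proj1 (proj2 Q2) t H).
      split; [apply P1|apply Q1].
    - rewrite (proj2 (proj2 P1) (t + s)); [|lra].
      rewrite (proj2 (proj2 Q1) (t + s)); [|lra]. split; [apply P2|apply Q2]. }
  destruct (completeness (fun s => ~ good s)) as [s0 [Hub Hlub]].
  { exists (2 * a). intros s Hs. destruct (Rle_lt_dec s (2 * a)); [lra|].
    exfalso. apply Hs, Hfar. lra. }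
  { now exists s1. }
  assert (Hs10 : s1 <= s0) by now apply Hub.
  assert (Hs02 : s0 <= 2 * a).
  { apply Hlub. intros s Hs. destruct (Rle_lt_dec s (2 * a)); [lra|].
    exfalso. apply Hs, Hfar. lra. }
  assert (Habove : forall s, s0 < s -> good s).
  { intros s Hs. apply NNPP. intros N. apply Hub in N. lra. }
  assert (Hlim : forall (x y : R -> R) t, lip (slope b r) x ->
     (forall s, s0 < s -> y t <= x (t + s)) -> y t <= x (t + s0)).
  { intros x y t Lx H. apply (lip_ge_of_right (slope b r)); [exact Lx|].
    intros s Hs. replace s with (t + (s - t)) by ring. apply H. lra. }
  assert (G0 : good s0).
  { intros t. split; apply Hlim; auto; intros s Hs; now apply Habove. }
  assert (Hshift := system_on_shift _ _ _ _ _ _ _ s0 _ _ S1).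
  assert (Sub : forall l u l' u' phi psi, system_on l u b h r e c phi psi ->
    l <= l' -> u' <= u -> system_on l' u' b h r e c phi psi).
  { intros l u l' u' phi psi [A B] ? ?.
    split; eapply ode_on_sub; eauto. }
  destruct (ordered_solutions_strict (- a) (a - s0) b h r e c
    (fun t => phi1 (t + s0)) (fun t => psi1 (t + s0)) phi2 psi2) as [A1 A2]; auto.
  { eapply Sub; [exact Hshift|lra|lra]. }
  { eapply Sub; [exact S2|lra|lra]. }
  { intros t. pose proof (G0 t). pose proof (proj1 P2 t). pose proof (proj1 Q2 t).
    pose proof (proj1 P1 (t + s0)). pose proof (proj1 Q1 (t + s0)). lra. }
  { intros t. repeat split; auto; apply (continuous_comp (fun t => t + s0)); auto;
    apply: continuous_plus; try apply: continuous_id; apply: continuous_const. }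
  assert (El : phi2 (- a) < phi1 (- a + s0) /\ psi2 (- a) < psi1 (- a + s0)).
  { rewrite (proj1 (proj2 P2)); [|lra]. rewrite (proj1 (proj2 Q2)); [|lra].
    destruct (Req_dec s0 (2 * a)) as [E|E].
    - rewrite (proj2 (proj2 P1)); [|lra]. rewrite (proj2 (proj2 Q1)); lra.
    - pose proof (I1 (- a + s0)). lra. }
  assert (Er : phi2 (a - s0) < phi1 (a - s0 + s0) /\ psi2 (a - s0) < psi1 (a - s0 + s0)).
  { rewrite (proj2 (proj2 P1) (a - s0 + s0)); [|lra].
    rewrite (proj2 (proj2 Q1) (a - s0 + s0)); [|lra].
    destruct (Req_dec s0 (2 * a)) as [E|E].
    - rewrite (proj1 (proj2 P2)); [|lra]. rewrite (proj1 (proj2 Q2)); lra.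
    - pose proof (I2 (a - s0)). lra. }
  assert (St : forall t, - a <= t <= a - s0 ->
    phi2 t < phi1 (t + s0) /\ psi2 t < psi1 (t + s0)).
  { intros t Ht. destruct (Req_dec t (- a)) as [->|N1]; [exact El|].
    destruct (Req_dec t (a - s0)) as [->|N2]; [exact Er|].
    split; [apply A1|apply A2]; lra. }
  destruct (shift_below_opens a (slope b r) s0 phi1 phi2) as [e1 [He1 G1]]; auto; try lra.
  { intros t Ht. now apply St. }
  destruct (shift_below_opens a (slope b r) s0 psi1 psi2) as [e2 [He2 G2]]; auto; try lra.
  { intros t Ht. now apply St. }
  assert (He12 : 0 < Rmin e1 e2) by now apply Rmin_glb_lt.
  enough (s0 <= s0 - Rmin e1 e2) by lra.
  apply Hlub. intros s Hs. apply Rnot_lt_le. intros N. apply Hs.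
  assert (s <= s0) by now apply Hub.
  pose proof (Rmin_l e1 e2). pose proof (Rmin_r e1 e2).
  intros t. split; [apply G1|apply G2]; lra.
Qed.

Lemma truncated_front_increasing (a b h r e c : R) (phi psi : R -> R) :
  0 < a -> 0 < b -> 1 < r -> 0 < e <= 1 -> 0 <= c ->
  truncated_front a b h r e c phi psi -> increasing phi /\ increasing psi.
Proof.
  intros Ha Hb Hr He Hc T.
  assert (S := sliding a b h r e c _ _ _ _ Ha Hb Hr He Hc T T).
  split; intros s t Hst; (destruct (Req_dec s t) as [->|N]; [lra|]);
  replace t with (s + (t - s)) by ring; apply S; lra.
Qed.

Lemma truncated_front_unique (a b h r e c : R) (phi1 psi1 phi2 psi2 : R -> R) :
  0 < a -> 0 < b -> 1 < r -> 0 < e <= 1 -> 0 <= c ->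
  truncated_front a b h r e c phi1 psi1 -> truncated_front a b h r e c phi2 psi2 ->
  forall t, psi1 t = psi2 t.
Proof.
  intros Ha Hb Hr He Hc T1 T2 t.
  assert (S := sliding a b h r e c _ _ _ _ Ha Hb Hr He Hc T1 T2).
  assert (S' := sliding a b h r e c _ _ _ _ Ha Hb Hr He Hc T2 T1).
  apply Rle_antisym.
  - apply (lip_ge_of_right (slope b r)); [apply T2|]. intros s Hs.
    replace s with (t + (s - t)) by ring. apply S'. lra.
  - apply (lip_ge_of_right (slope b r)); [apply T1|]. intros s Hs.
    replace s with (t + (s - t)) by ring. apply S. lra.
Qed.

(** * Bounds on the fast front and on the standing front *)

Lemma increasing_derive_nonneg (x : R -> R) (t d : R) :
  increasing x -> is_derive x t d -> 0 <= d.
Proof.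
  intros Hx D. apply Rnot_lt_le. intros N.
  destruct (derive_pos_increases (fun s => - x s) t (- d)) as [eta [He [A _]]].
  { now apply: is_derive_opp. } { lra. }
  assert (B := A (t + eta / 2) ltac:(lra)).
  assert (C := Hx t (t + eta / 2) ltac:(lra)). lra.
Qed.

(** With speed 3 + b the exponential exp(t - a), equal to 1 at the right end,
    dominates both components.  The reaction of phi has a positive zeroth-order
    part, which the maximum principle tolerates only after division by exp t. *)
Lemma fast_front_low (a b h r e : R) (phi psi : R -> R) :
  0 < a -> 0 < b -> 1 < r -> 0 < e <= 1 ->
  truncated_front a b h r e (3 + b) phi psi -> psi 0 <= exp (- a).
Proof.
  intros Ha Hb Hr He [P [Q [L [M [O1 O2]]]]].
  set (c := 3 + b) in *.
  assert (C1 := lip_continuous _ _ L). assert (C2 := lip_continuous _ _ M).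
  assert (D1 := ode_on_derive _ _ _ _ _ O1).
  assert (D2 := ode_on_derive _ _ _ _ _ O2).
  assert (De : forall t : R, is_derive (fun t : R => exp (- t)) t (- exp (- t))).
  { intros t. auto_derive; [trivial|lra]. }
  assert (De' : forall t : R, is_derive (fun t => exp (t - a)) t (exp (t - a))).
  { intros t. unfold Rminus. auto_derive; [trivial|lra]. }
  assert (Hphi : forall t, - a <= t <= a -> phi t <= exp (t - a)).
  { intros t Ht.
    enough (A : 0 <= exp (- a) - phi t * exp (- t)).
    { unfold Rminus. rewrite exp_plus.
      assert (E : exp t * exp (- t) = 1).
      { rewrite -exp_plus. replace (t + - t) with 0 by ring. apply exp_0. }
      assert (0 < exp t) by apply exp_pos.
      replace (phi t) with (phi t * (exp t * exp (- t))) by (rewrite E; ring). nra. }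
    revert t Ht.
    apply (min_principle (- a) a (fun t => exp (- a) - phi t * exp (- t))
      (fun t => - ((Derive phi t - phi t) * exp (- t)))
      (fun t => - ((c * Derive phi t - react_u r (phi t) (psi (t - c * h)) - Derive phi t)
                   * exp (- t) - (Derive phi t - phi t) * exp (- t)))); try lra.
    - intros t Ht. split.
      + derive_value (0 - (Derive phi t * exp (- t) + phi t * (- exp (- t)))).
        apply: is_derive_minus; [apply: is_derive_const|].
        apply: (is_derive_mult phi (fun t => exp (- t))); auto.
        intros; apply Rmult_comm.
      + apply: is_derive_opp.
        derive_value
          ((c * Derive phi t - react_u r (phi t) (psi (t - c * h)) - Derive phi t) * exp (- t)
           + (Derive phi t - phi t) * (- exp (- t))).
        apply: (is_derive_mult (fun t => Derive phi t - phi t) (fun t => exp (- t))); auto.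
        * apply: is_derive_minus; [now apply O1|now apply D1].
        * intros; apply Rmult_comm.
    - intros t _. apply: continuous_minus; [apply: continuous_const|].
      apply: continuous_mult; [apply C1|]. eapply derive_continuous, De.
    - rewrite (proj1 (proj2 P)); [|lra]. pose proof (exp_pos (- a)). lra.
    - rewrite (proj2 (proj2 P)); lra.
    - intros t Ht Hn Hz.
      assert (E := exp_pos (- t)). assert (E' := exp_pos (- a)).
      (* At a critical point of exp(- t) phi one has phi' = phi. *)
      assert (Dz : Derive phi t = phi t) by nra. rewrite Dz.
      assert (0 < phi t) by nra.
      assert (B1 := proj1 P t). assert (B2 := proj1 Q (t - c * h)).
      assert (react_u r (phi t) (psi (t - c * h)) <= phi t).
      { unfold react_u. assert (r * psi (t - c * h) <= r) by nra. nra. }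
      unfold c in *. nra. }
  replace (- a) with (0 - a) by ring.
  enough (A : forall t, - a <= t <= a -> 0 <= exp (t - a) - psi t).
  { specialize (A 0). lra. }
  apply (min_principle (- a) a (fun t => exp (t - a) - psi t)
    (fun t => exp (t - a) - Derive psi t)
    (fun t => exp (t - a) - (c * Derive psi t - react_v b e (phi t) (psi t)))); try lra.
  - intros t Ht. split; apply: is_derive_minus; auto. now apply O2.
  - intros t _. apply: continuous_minus; [|apply C2]. eapply derive_continuous, De'.
  - rewrite (proj1 (proj2 Q)); [|lra]. pose proof (exp_pos (- a - a)). lra.
  - rewrite (proj2 (proj2 Q)); [|lra]. rewrite Rminus_diag exp_0. lra.
  - intros t Ht Hn Hz.
    assert (A := Hphi t ltac:(lra)). assert (E := exp_pos (t - a)).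
    assert (B1 := proj1 P t). assert (B2 := proj1 Q t).
    assert (react_v b e (phi t) (psi t) <= b * phi t).
    { unfold react_v.
      assert (0 <= b * (phi t * psi t)) by (apply Rmult_le_pos; nra).
      assert (0 <= e * (psi t * (1 - psi t))) by (apply Rmult_le_pos; nra). nra. }
    assert (b * phi t <= b * exp (t - a)) by nra.
    replace (Derive psi t) with (exp (t - a)) by lra. unfold c. nra.
Qed.

(** To the right of a suitable point k bounds the slope of psi, thanks to
    e <= k^2 / 4 and a >= 2 / k.  Levels of psi are measured by q = 1 / (4 r):
    (r - 1) / r is 1 - 4 q, and psi takes a time of at least q / k to cross from
    1 - 2 q to 1 - q. *)
Lemma standing_front_high (a b h r e k : R) (phi psi : R -> R) :
  0 < b -> 1 < r -> 0 < e <= 1 ->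
  0 < k -> k <= / (40 * r) -> k * k < b / (256 * (r * r)) ->
  e <= k * k / 4 -> e <= b / 8 -> 2 / k <= a ->
  truncated_front a b h r e 0 phi psi -> (r - 1) / r < psi 0.
Proof.
  intros Hb Hr He Hk Hk1 Hk2 He1 He2 Hak T.
  assert (Ha : 0 < a).
  { apply Rlt_le_trans with (2 / k); [apply Rdiv_lt_0_compat; lra|exact Hak]. }
  destruct (truncated_front_increasing a b h r e 0 phi psi) as [Iphi Ipsi]; try lra; auto.
  assert (Hin := truncated_front_inside a b h r e 0 phi psi Ha Hb Hr He ltac:(lra) T).
  destruct T as [P [Q [L [M [O1 O2]]]]].
  assert (C1 := lip_continuous _ _ L). assert (C2 := lip_continuous _ _ M).
  assert (D1 := ode_on_derive _ _ _ _ _ O1).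
  assert (D2 := ode_on_derive _ _ _ _ _ O2).
  assert (DD1 : forall t, - a < t < a ->
    is_derive (Derive phi) t (- react_u r (phi t) (psi t))).
  { intros t Ht. replace (- _) with (0 * Derive phi t - react_u r (phi t) (psi (t - 0 * h))).
    - now apply O1.
    - replace (t - 0 * h) with t by ring. ring. }
  assert (DD2 : forall t, - a < t < a ->
    is_derive (Derive psi) t (- react_v b e (phi t) (psi t))).
  { intros t Ht. replace (- _) with (0 * Derive psi t - react_v b e (phi t) (psi t)) by ring.
    now apply O2. }
  assert (N1 : forall t, - a < t < a -> 0 <= Derive phi t).
  { intros t Ht. apply (increasing_derive_nonneg phi t); auto. }
  assert (N2 : forall t, - a < t < a -> 0 <= Derive psi t).
  { intros t Ht. apply (increasing_derive_nonneg psi t); auto. }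
  apply Rnot_le_lt. intros Hlow.
  destruct (mean_value psi (Derive psi) (- a) 0) as [tau [Htau Etau]]; try lra; auto.
  { intros t Ht. apply D2. lra. }
  assert (Dtau : Derive psi tau <= k / 2).
  { rewrite (proj1 (proj2 Q) (- a)) in Etau; [|lra].
    assert (B := proj1 Q 0).
    assert (1 <= a * (k / 2)).
    { apply Rle_trans with (2 / k * (k / 2)); [right; field; lra|].
      apply Rmult_le_compat_r; lra. }
    assert (0 <= Derive psi tau) by (apply N2; lra). nra. }
  (* Energy estimate: psi'' <= e psi and psi' >= 0 make psi'^2 - e psi^2
     nonincreasing. *)
  assert (Dk : forall t, tau <= t < a -> Derive psi t <= k).
  { intros t Ht.
    set (E := fun t => Derive psi t * Derive psi t - e * (psi t * psi t)).
    assert (DE : forall s, - a < s < a -> is_derive E s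
      ((- react_v b e (phi s) (psi s) * Derive psi s + Derive psi s * - react_v b e (phi s) (psi s))
       - e * (Derive psi s * psi s + psi s * Derive psi s))).
    { intros s Hs. apply: is_derive_minus.
      - apply: (is_derive_mult (Derive psi) (Derive psi)); auto.
        intros; apply Rmult_comm.
      - apply: is_derive_scal. apply: (is_derive_mult psi psi); auto.
        intros; apply Rmult_comm. }
    assert (A : E t <= E tau).
    { eapply nonincreasing_of_derive; [lra| |].
      - intros s Hs. split; [apply DE; lra|].
        assert (A := N2 s ltac:(lra)). assert (B1 := proj1 P s). assert (B2 := proj1 Q s).
        enough (0 <= Derive psi s * (react_v b e (phi s) (psi s) + e * psi s)) by nra.
        apply Rmult_le_pos; [exact A|]. unfold react_v.
        assert (0 <= b * (phi s * (1 - psi s))).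
        { apply Rmult_le_pos; [lra|]. apply Rmult_le_pos; lra. }
        assert (0 <= e * (psi s * psi s)).
        { apply Rmult_le_pos; [lra|]. apply Rmult_le_pos; lra. }
        nra.
      - intros s Hs. eapply derive_continuous. apply DE. lra. }
    unfold E in A. assert (B := proj1 Q t). assert (B' := proj1 Q tau).
    assert (A1 := N2 t ltac:(lra)). assert (A2 := N2 tau ltac:(lra)).
    assert (B1 : psi t * psi t <= 1) by nra.
    assert (e * (psi t * psi t) <= e) by nra.
    assert (0 <= e * (psi tau * psi tau)) by (apply Rmult_le_pos; nra).
    assert (Derive psi t * Derive psi t <= k * k) by nra.
    apply Rnot_lt_le. intros N. nra. }
  set (q := / (4 * r)).
  assert (Hq : 0 < q < 1 / 4).
  { unfold q. split; [apply Rinv_0_lt_compat; lra|].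
    apply Rmult_lt_reg_r with (4 * r); [lra|]. rewrite Rinv_l; lra. }
  assert (Hqr : r * q = / 4) by (unfold q; field; lra).
  assert (Hk1' : 10 * k <= q).
  { replace q with (10 * / (40 * r)) by (unfold q; field; lra). lra. }
  assert (Hk2' : k * k < b * (q * q) / 16).
  { replace (b * (q * q) / 16) with (b / (256 * (r * r))); [exact Hk2|].
    unfold q. field. lra. }
  assert (Hlow' : psi 0 <= 1 - 4 * q).
  { replace (1 - 4 * q) with ((r - 1) / r); [exact Hlow|]. unfold q. field. lra. }
  assert (Cpsi : continuity psi).
  { intros t. apply continuity_pt_filterlim, C2. }
  assert (Pa : psi a = 1) by (apply Q; lra).
  destruct (IVT_gen psi 0 a (1 - 2 * q) Cpsi) as [t1 [Ht1 E1]].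
  { rewrite Rmin_left; [|lra]. rewrite Rmax_right; lra. }
  rewrite Rmin_left in Ht1; [|lra]. rewrite Rmax_right in Ht1; [|lra].
  assert (Ht1a : t1 < a).
  { destruct (Req_dec t1 a) as [E|]; [rewrite E in E1; lra|lra]. }
  destruct (IVT_gen psi t1 a (1 - q) Cpsi) as [t2 [Ht2 E2]].
  { rewrite Rmin_left; [|lra]. rewrite Rmax_right; lra. }
  rewrite Rmin_left in Ht2; [|lra]. rewrite Rmax_right in Ht2; [|lra].
  assert (Ht2a : t1 < t2 < a).
  { destruct (Req_dec t2 a) as [E|]; [rewrite E in E2; lra|].
    destruct (Req_dec t1 t2) as [E|]; [rewrite E in E1; lra|lra]. }
  assert (Hlen : q <= k * (t2 - t1)).
  { destruct (mean_value psi (Derive psi) t1 t2) as [s [Hs Es]]; try lra; auto.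
    - intros; apply D2; lra.
    - assert (A := Dk s ltac:(lra)). nra. }
  assert (Hlen10 : 10 <= t2 - t1) by nra.
  set (t3 := t1 + 5).
  (* If phi stayed below 1/4 it would be concave on [t1, t3] with
     phi'' <= - phi / 4.  Concavity on the first half bounds phi' at the midpoint tm by
     (2/5) phi(tm), and the second half lowers it by at least (5/8) phi(tm). *)
  assert (Hphi3 : 1 / 4 <= phi t3).
  { apply Rnot_lt_le. intros N.
    assert (HF : forall t, t1 <= t <= t3 -> phi t / 4 <= react_u r (phi t) (psi t)).
    { intros t Ht. assert (A := Ipsi t1 t ltac:(lra)). assert (A' := Iphi t t3 ltac:(lra)).
      assert (B := proj1 P t). unfold react_u.
      assert (r * (1 - 2 * q) <= r * psi t) by (apply Rmult_le_compat_l; lra).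
      assert (1 / 4 <= 1 - r - phi t + r * psi t) by nra. nra. }
    set (tm := t1 + 5 / 2). unfold t3 in *.
    destruct (mean_value phi (Derive phi) t1 tm) as [s [Hs Es]];
      try (unfold tm; lra); auto.
    { intros; apply D1. unfold tm in *. lra. }
    destruct (mean_value (Derive phi) (fun t => - react_u r (phi t) (psi t)) tm (t1 + 5))
      as [w [Hw Ew]].
    { unfold tm; lra. } { intros; apply DD1; unfold tm in *; lra. }
    { intros. eapply derive_continuous. apply DD1; unfold tm in *; lra. }
    assert (A : Derive phi tm <= Derive phi s).
    { apply (nonincreasing_of_derive _ (fun t => - react_u r (phi t) (psi t))).
      - lra.
      - intros t Ht. split; [apply DD1; unfold tm in *; lra|].
        assert (A := HF t ltac:(unfold tm in *; lra)). assert (B := proj1 P t). lra.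
      - intros t Ht. eapply derive_continuous. apply DD1; unfold tm in *; lra. }
    assert (B := HF w ltac:(unfold tm in *; lra)).
    assert (B' := Iphi tm w ltac:(lra)).
    assert (B1 := proj1 P t1). assert (B2 := Hin tm ltac:(unfold tm; lra)).
    assert (B3 := N1 (t1 + 5) ltac:(lra)).
    replace (tm - t1) with (5 / 2) in Es by (unfold tm; ring).
    replace (t1 + 5 - tm) with (5 / 2) in Ew by (unfold tm; field).
    lra. }
  destruct (mean_value (Derive psi) (fun t => - react_v b e (phi t) (psi t)) t3 t2)
    as [s [Hs Es]].
  { unfold t3; lra. } { intros; apply DD2; unfold t3 in *; lra. }
  { intros. eapply derive_continuous. apply DD2; unfold t3 in *; lra. }
  (* Here phi >= 1/4 and e <= b / 8, while 1 - psi >= q. *)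
  assert (HG : b / 8 * q <= react_v b e (phi s) (psi s)).
  { assert (A := Iphi t3 s ltac:(lra)). assert (A' := Ipsi s t2 ltac:(lra)).
    assert (B := proj1 Q s). unfold react_v. apply Rmult_le_compat; try lra; nra. }
  assert (A := Dk t3 ltac:(unfold t3; lra)).
  assert (B := N2 t2 ltac:(lra)).
  assert (Hbq : 0 < b * q) by nra.
  assert (Hlen2 : (t2 - t1) / 2 <= t2 - t3) by (unfold t3; lra).
  assert (b / 8 * q * ((t2 - t1) / 2) <= k).
  { apply Rle_trans with (react_v b e (phi s) (psi s) * (t2 - t3)); [|nra].
    apply Rmult_le_compat; lra. }
  assert (b / 8 * q * (k * (t2 - t1) / 2) <= k * k) by nra.
  assert (b / 8 * q * (q / 2) <= b / 8 * q * (k * (t2 - t1) / 2)).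
  { apply Rmult_le_compat_l; lra. }
  lra.
Qed.

(** * Limits of fronts along an ultrafilter *)

Lemma nat_ultrafilter :
  exists U : (nat -> Prop) -> Prop, ProperFilter U /\
    (forall P, eventually P -> U P) /\ forall P, U P \/ U (fun n => ~ P n).
Proof.
  assert (E : filter.ProperFilter eventually).
  { constructor.
    - intros [N HN]. exact (HN N (le_n N)).
    - constructor.
      + now exists 0%nat.
      + intros P Q HP HQ. exact (filter_and P Q HP HQ).
      + intros P Q HPQ. exact (filter_imp P Q HPQ). }
  destruct (filter.ultraFilterLemma E) as [U [HU HE]].
  destruct (@filter.ultra_proper _ _ HU) as [U0 [UT UI US]].
  exists U. split; [|split].
  - constructor.
    + intros P HP. apply NNPP. intros N. apply U0.
      apply (US P); [|exact HP]. intros n Pn. apply N. now exists n.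
    + constructor.
      * exact UT.
      * intros P Q. exact (UI P Q).
      * intros P Q. exact (US P Q).
  - exact HE.
  - intros P. exact (@filter.in_ultra_setVsetC _ U P HU).
Qed.

(** Used both for sequences along an ultrafilter and for functions on the line at
    an infinite end; in the second case it coincides with [is_lim]. *)
Definition tends {T : Type} (U : (T -> Prop) -> Prop) (u : T -> R) (l : R) : Prop :=
  filterlim u U (locally l).

Lemma tends_iff {T : Type} (U : (T -> Prop) -> Prop) {HU : Filter U} (u : T -> R) (l : R) :
  tends U u l <-> forall eps, 0 < eps -> U (fun n => Rabs (u n - l) < eps).
Proof.
  split.
  - intros H eps He. apply (proj1 (filterlim_locally u l) H (mkposreal eps He)).
  - intros H. apply (proj2 (filterlim_locally u l)). intros eps. apply (H eps), cond_pos.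
Qed.

Lemma tends_const {T : Type} (U : (T -> Prop) -> Prop) {HU : Filter U} (k : R) :
  tends U (fun _ => k) k.
Proof. apply filterlim_const. Qed.

Lemma tends_plus {T : Type} (U : (T -> Prop) -> Prop) {HU : Filter U} (u v : T -> R) (k l : R) :
  tends U u k -> tends U v l -> tends U (fun n => u n + v n) (k + l).
Proof. intros Hu Hv. exact (filterlim_comp_2 u v Rplus Hu Hv (filterlim_plus k l)). Qed.

Lemma tends_mult {T : Type} (U : (T -> Prop) -> Prop) {HU : Filter U} (u v : T -> R) (k l : R) :
  tends U u k -> tends U v l -> tends U (fun n => u n * v n) (k * l).
Proof. intros Hu Hv. exact (filterlim_comp_2 u v Rmult Hu Hv (filterlim_mult k l)). Qed.

Lemma tends_minus {T : Type} (U : (T -> Prop) -> Prop) {HU : Filter U} (u v : T -> R) (k l : R) :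
  tends U u k -> tends U v l -> tends U (fun n => u n - v n) (k - l).
Proof.
  intros Hu Hv. apply (tends_plus U); [exact Hu|].
  exact (filterlim_comp _ _ _ v Ropp U _ _ Hv (filterlim_opp l)).
Qed.

Lemma tends_le {T : Type} (U : (T -> Prop) -> Prop) {HU : ProperFilter U} (u v : T -> R) (k l : R) :
  tends U u k -> tends U v l -> U (fun n => u n <= v n) -> k <= l.
Proof. intros Hu Hv H. exact (filterlim_le u v k l H Hu Hv). Qed.

Lemma tends_abs_le {T : Type} (U : (T -> Prop) -> Prop) {HU : ProperFilter U}
    (u : T -> R) (k M : R) :
  tends U u k -> U (fun n => Rabs (u n) <= M) -> Rabs k <= M.
Proof.
  intros Hu H. apply Rabs_le. split.
  - eapply (tends_le U _ _ _ _ (tends_const U (- M)) Hu).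
    apply: filter_imp H => n H. apply Rabs_le_between in H. lra.
  - eapply (tends_le U _ _ _ _ Hu (tends_const U M)).
    apply: filter_imp H => n H. apply Rabs_le_between in H. lra.
Qed.

Lemma tends_unique {T : Type} (U : (T -> Prop) -> Prop) {HU : ProperFilter U}
    (u : T -> R) (k l : R) : tends U u k -> tends U u l -> k = l.
Proof.
  intros Hk Hl. apply Rle_antisym; eapply (tends_le U); eauto;
    apply filter_forall; intros; lra.
Qed.

(** The limit is the supremum of the numbers that U-often lie below the sequence. *)
Lemma ultrafilter_bounded_tends (U : (nat -> Prop) -> Prop) {HU : ProperFilter U}
    (u : nat -> R) (M : R) :
  (forall P, U P \/ U (fun n => ~ P n)) ->
  U (fun n => Rabs (u n) <= M) -> exists l, tends U u l.
Proof.
  intros Hultra HM.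
  destruct (completeness (fun x => U (fun n => x <= u n))) as [l [Hub Hlub]].
  - exists M. intros x Hx. destruct (filter_ex _ (filter_and _ _ Hx HM)) as [n [H1 H2]].
    apply Rabs_le_between in H2. lra.
  - exists (- M). apply: filter_imp HM => n H. apply Rabs_le_between in H. lra.
  - exists l. apply (tends_iff U). intros eps He.
    assert (A : U (fun n => l - eps < u n)).
    { apply NNPP. intros N. enough (l <= l - eps) by lra.
      apply Hlub. intros x Hx. apply Rnot_lt_le. intros Hlt. apply N.
      apply: filter_imp Hx => n H. lra. }
    assert (B : U (fun n => ~ l + eps / 2 <= u n)).
    { destruct (Hultra (fun n => l + eps / 2 <= u n)) as [H|H]; [|exact H].
      apply Hub in H. lra. }
    apply: filter_imp (filter_and _ _ A B) => n [H1 H2]. apply Rabs_lt_between. lra.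
Qed.

(** A Lipschitz derivative gives |f s - f t - (s - t) f' t| <= Lam (s - t)^2, an
    inequality without derivatives or quantified neighbourhoods, which passes to
    pointwise limits and characterises the limit of f' as a derivative. *)
Lemma derive_of_tends (U : (nat -> Prop) -> Prop) {HU : ProperFilter U}
    (l u Lam : R) (f f' : nat -> R -> R) (x x' : R -> R) :
  0 <= Lam ->
  U (fun n => forall t, l < t < u -> is_derive (f n) t (f' n t)) ->
  U (fun n => forall s t, l < s < u -> l < t < u ->
       Rabs (f' n s - f' n t) <= Lam * Rabs (s - t)) ->
  (forall t, l < t < u -> tends U (fun n => f n t) (x t)) ->
  (forall t, l < t < u -> tends U (fun n => f' n t) (x' t)) ->
  forall t, l < t < u -> is_derive x t (x' t).
Proof.
  intros HLam Hd Hl Hx Hx' t Ht.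
  assert (Q : forall s, l < s < u ->
    Rabs (x s - x t - (s - t) * x' t) <= Lam * (Rabs (s - t) * Rabs (s - t))).
  { intros s Hs.
    apply (tends_abs_le U (fun n => f n s - f n t - (s - t) * f' n t)).
    - apply (tends_minus U); [apply (tends_minus U); auto|].
      apply (tends_mult U); [apply (tends_const U)|auto].
    - apply: filter_imp (filter_and _ _ Hd Hl) => n [D Lp].
      assert (M : exists y, l < y < u /\ Rabs (y - t) <= Rabs (s - t) /\
        f n s - f n t = f' n y * (s - t)).
      { destruct (Rtotal_order s t) as [N|[->|N]].
        - destruct (mean_value (f n) (f' n) s t) as [y [Hy E]]; try lra.
          + intros y Hy. apply D. lra.
          + intros y Hy. eapply derive_continuous, D. lra.
          + exists y. split; [lra|]. split; [|lra].
            rewrite !Rabs_left1; lra.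
        - exists t. split; [lra|]. split; [lra|ring].
        - destruct (mean_value (f n) (f' n) t s) as [y [Hy E]]; try lra.
          + intros y Hy. apply D. lra.
          + intros y Hy. eapply derive_continuous, D. lra.
          + exists y. split; [lra|]. split; [|lra].
            rewrite !Rabs_pos_eq; lra. }
      destruct M as [y [Hy [Hyt E]]]. rewrite E.
      replace (_ - _) with ((f' n y - f' n t) * (s - t)) by ring.
      rewrite Rabs_mult -Rmult_assoc. apply Rmult_le_compat_r; [apply Rabs_pos|].
      apply Rle_trans with (1 := Lp y t Hy Ht). now apply Rmult_le_compat_l. }
  apply is_derive_Reals. intros eps He.
  assert (Hd0 : 0 < Rmin (Rmin (t - l) (u - t)) (eps / (Lam + 1))).
  { apply Rmin_glb_lt; [apply Rmin_glb_lt; lra|apply Rdiv_lt_0_compat; lra]. }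
  exists (mkposreal _ Hd0). intros k Hk Hkd. simpl in Hkd.
  assert (A1 := Rlt_le_trans _ _ _ Hkd (Rmin_l _ _)).
  assert (A2 := Rlt_le_trans _ _ _ Hkd (Rmin_r _ _)).
  assert (A3 := Rlt_le_trans _ _ _ A1 (Rmin_l _ _)).
  assert (A4 := Rlt_le_trans _ _ _ A1 (Rmin_r _ _)).
  apply Rabs_lt_between in A3. apply Rabs_lt_between in A4.
  assert (B := Q (t + k) ltac:(lra)). replace (t + k - t) with k in B by ring.
  assert (Pk := Rabs_pos_lt k Hk).
  replace (_ - _) with ((x (t + k) - x t - k * x' t) / k) by (field; exact Hk).
  rewrite Rabs_div; [|exact Hk].
  apply Rmult_lt_reg_r with (Rabs k); [exact Pk|].
  unfold Rdiv. rewrite Rmult_assoc Rinv_l; [|lra]. rewrite Rmult_1_r.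
  apply Rle_lt_trans with (1 := B).
  rewrite -Rmult_assoc. apply Rmult_lt_compat_r; [exact Pk|].
  apply Rle_lt_trans with ((Lam + 1) * Rabs k); [nra|].
  apply Rmult_lt_reg_r with (/ (Lam + 1)); [apply Rinv_0_lt_compat; lra|].
  unfold Rdiv in A2. rewrite (Rmult_comm (Lam + 1)) Rmult_assoc Rinv_r; lra.
Qed.

Lemma lip_derive (L : R) (x : R -> R) (t d : R) :
  lip L x -> is_derive x t d -> Rabs d <= L.
Proof.
  intros Lx D. apply Rnot_lt_le. intros N.
  assert (H := proj1 (is_derive_Reals _ _ _) D (Rabs d - L) ltac:(lra)).
  destruct H as [eta H]. assert (He := cond_pos eta).
  set (k := eta / 2). assert (Hk : 0 < k) by (unfold k; lra).
  specialize (H k ltac:(lra)). rewrite (Rabs_pos_eq k) in H; [|lra].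
  specialize (H ltac:(unfold k; lra)).
  assert (B := Lx (t + k) t). replace (t + k - t) with k in B by ring.
  rewrite (Rabs_pos_eq k) in B; [|lra].
  set (q := (x (t + k) - x t) / k) in *.
  assert (E : x (t + k) - x t = q * k) by (unfold q; field; lra).
  rewrite E Rabs_mult (Rabs_pos_eq k) in B; [|lra].
  assert (Rabs q <= L) by nra.
  pose proof (Rabs_triang_inv d q) as T. rewrite Rabs_minus_sym in T. lra.
Qed.

Lemma derive_bounded_lip (l u M : R) (f f' : R -> R) :
  (forall t, l < t < u -> is_derive f t (f' t)) ->
  (forall t, l < t < u -> Rabs (f' t) <= M) ->
  forall s t, l < s < u -> l < t < u -> Rabs (f s - f t) <= M * Rabs (s - t).
Proof.
  intros D B.
  assert (W : forall s t, l < s < u -> l < t < u -> s < t ->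
     Rabs (f s - f t) <= M * Rabs (s - t)).
  { intros s t Hs Ht Hst.
    destruct (mean_value f f' s t) as [y [Hy E]]; auto.
    - intros y Hy. apply D. lra.
    - intros y Hy. eapply derive_continuous, D. lra.
    - rewrite Rabs_minus_sym E Rabs_mult (Rabs_minus_sym s).
      apply Rmult_le_compat_r; [apply Rabs_pos|]. apply B. lra. }
  intros s t Hs Ht. destruct (Rtotal_order s t) as [N|[->|N]].
  - now apply W.
  - rewrite !Rminus_diag Rabs_R0. lra.
  - rewrite Rabs_minus_sym (Rabs_minus_sym s). now apply W.
Qed.

(** First and second derivatives are bounded and Lipschitz uniformly in n, so
    [derive_of_tends] applies twice. *)
Lemma ode_on_tends (U : (nat -> Prop) -> Prop) {HU : ProperFilter U}
    (l u C L M Lg c : R) (cn : nat -> R) (xn gn : nat -> R -> R) (x g : R -> R) :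
  (forall P, U P \/ U (fun n => ~ P n)) ->
  0 <= C -> 0 <= L -> 0 <= M -> 0 <= Lg ->
  (forall n, 0 <= cn n <= C) -> (forall n, lip L (xn n)) ->
  (forall n t, Rabs (gn n t) <= M) -> (forall n, lip Lg (gn n)) ->
  U (fun n => ode_on l u (cn n) (xn n) (gn n)) ->
  tends U cn c ->
  (forall t, tends U (fun n => xn n t) (x t)) ->
  (forall t, tends U (fun n => gn n t) (g t)) ->
  ode_on l u c x g.
Proof.
  intros Hultra HC HL HM HLg Hcn Lx Bg Lpg HO Tc Tx Tg.
  assert (B1 : U (fun n => forall t, l < t < u -> Rabs (Derive (xn n) t) <= L)).
  { apply: filter_imp HO => n O t Ht. eapply lip_derive; [apply Lx|].
    eapply ode_on_derive; eauto. }
  assert (B2 : U (fun n => forall t, l < t < u ->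
     Rabs (cn n * Derive (xn n) t - gn n t) <= C * L + M)).
  { apply: filter_imp B1 => n B t Ht. specialize (B t Ht).
    assert (A := Bg n t). assert (A' := Hcn n).
    assert (Rabs (cn n * Derive (xn n) t) <= C * L).
    { rewrite Rabs_mult (Rabs_pos_eq (cn n)); [|lra].
      apply Rmult_le_compat; try lra. apply Rabs_pos. }
    unfold Rminus. apply Rle_trans with (1 := Rabs_triang _ _). rewrite Rabs_Ropp. lra. }
  assert (B3 : U (fun n => forall s t, l < s < u -> l < t < u ->
     Rabs (Derive (xn n) s - Derive (xn n) t) <= (C * L + M) * Rabs (s - t))).
  { apply: filter_imp (filter_and _ _ HO B2) => n [O B].
    apply derive_bounded_lip with (fun t => cn n * Derive (xn n) t - gn n t); auto.
    intros t Ht. now apply O. }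
  assert (HCL : 0 <= C * L) by now apply Rmult_le_pos.
  assert (B4 : U (fun n => forall s t, l < s < u -> l < t < u ->
     Rabs ((cn n * Derive (xn n) s - gn n s) - (cn n * Derive (xn n) t - gn n t))
       <= (C * (C * L + M) + Lg) * Rabs (s - t))).
  { apply: filter_imp B3 => n B s t Hs Ht. specialize (B s t Hs Ht).
    assert (A := Lpg n s t). assert (A' := Hcn n).
    assert (Rabs (cn n * (Derive (xn n) s - Derive (xn n) t))
             <= C * ((C * L + M) * Rabs (s - t))).
    { rewrite Rabs_mult (Rabs_pos_eq (cn n)); [|lra].
      apply Rmult_le_compat; try lra. apply Rabs_pos. }
    replace (_ - _) with
      (cn n * (Derive (xn n) s - Derive (xn n) t) + - (gn n s - gn n t)) by ring.
    apply Rle_trans with (1 := Rabs_triang _ _). rewrite Rabs_Ropp. lra. }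
  assert (Ex : forall t, exists p, l < t < u -> tends U (fun n => Derive (xn n) t) p).
  { intros t. destruct (classic (l < t < u)) as [Ht|N]; [|now exists 0].
    destruct (ultrafilter_bounded_tends U (fun n => Derive (xn n) t) L Hultra) as [p Hp].
    - apply: filter_imp B1 => n B. now apply B.
    - now exists p. }
  destruct (choice _ Ex) as [x1 Tx1].
  apply ode_on_of_derives with x1.
  - apply (derive_of_tends U l u (C * L + M) xn (fun n => Derive (xn n))); auto; try lra.
    apply: filter_imp HO => n O t Ht. eapply ode_on_derive; eauto.
  - apply (derive_of_tends U l u (C * (C * L + M) + Lg) (fun n => Derive (xn n))
       (fun n t => cn n * Derive (xn n) t - gn n t)); auto.
    + assert (0 <= C * (C * L + M)) by (apply Rmult_le_pos; lra). lra.
    + apply: filter_imp HO => n O t Ht. now apply O.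
    + intros t Ht. apply (tends_minus U); [ |apply Tg].
      apply (tends_mult U); [exact Tc|now apply Tx1].
Qed.

Lemma react_u_abs_le (r x y : R) :
  1 < r -> 0 <= x <= 1 -> 0 <= y <= 1 -> Rabs (react_u r x y) <= 1 + r.
Proof.
  intros Hr Hx Hy. unfold react_u. rewrite Rabs_mult (Rabs_pos_eq x); [|lra].
  assert (Rabs (1 - r - x + r * y) <= 1 + r) by (apply Rabs_le; nra).
  pose proof (Rabs_pos (1 - r - x + r * y)). nra.
Qed.

Lemma react_v_abs_le (b e x y : R) :
  0 < b -> 0 < e <= 1 -> 0 <= x <= 1 -> 0 <= y <= 1 ->
  Rabs (react_v b e x y) <= b + 1.
Proof.
  intros Hb He Hx Hy. unfold react_v. rewrite Rabs_mult (Rabs_pos_eq (1 - y)); [|lra].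
  assert (Rabs (b * x - e * y) <= b + 1) by (apply Rabs_le; nra).
  pose proof (Rabs_pos (b * x - e * y)). nra.
Qed.

Lemma react_u_lip (r x1 x2 y1 y2 : R) :
  1 < r -> 0 <= x1 <= 1 -> 0 <= x2 <= 1 -> 0 <= y1 <= 1 -> 0 <= y2 <= 1 ->
  Rabs (react_u r x1 y1 - react_u r x2 y2) <= (3 + 2 * r) * Rabs (x1 - x2) + r * Rabs (y1 - y2).
Proof.
  intros Hr H1 H2 H3 H4. unfold react_u.
  replace (_ - _) with
   ((x1 - x2) * (1 - r - (x1 + x2) + r * y1) + r * x2 * (y1 - y2)) by ring.
  apply Rle_trans with (1 := Rabs_triang _ _). rewrite !Rabs_mult.
  rewrite (Rabs_pos_eq r) ?(Rabs_pos_eq x2); try lra.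
  assert (Rabs (1 - r - (x1 + x2) + r * y1) <= 3 + 2 * r) by (apply Rabs_le; nra).
  pose proof (Rabs_pos (x1 - x2)). pose proof (Rabs_pos (y1 - y2)).
  apply Rplus_le_compat.
  - rewrite Rmult_comm. now apply Rmult_le_compat_r.
  - apply Rmult_le_compat_r; nra.
Qed.

Lemma react_v_lip (b e x1 x2 y1 y2 : R) :
  0 < b -> 0 < e <= 1 ->
  0 <= x1 <= 1 -> 0 <= x2 <= 1 -> 0 <= y1 <= 1 -> 0 <= y2 <= 1 ->
  Rabs (react_v b e x1 y1 - react_v b e x2 y2) <= b * Rabs (x1 - x2) + (3 + b) * Rabs (y1 - y2).
Proof.
  intros Hb He H1 H2 H3 H4. unfold react_v.
  replace (_ - _) with
   (b * (1 - y1) * (x1 - x2) + (y1 - y2) * (- e - b * x2 + e * (y1 + y2))) by ring.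
  apply Rle_trans with (1 := Rabs_triang _ _). rewrite !Rabs_mult.
  rewrite (Rabs_pos_eq b) ?(Rabs_pos_eq (1 - y1)); try lra.
  assert (Rabs (- e - b * x2 + e * (y1 + y2)) <= 3 + b) by (apply Rabs_le; nra).
  pose proof (Rabs_pos (x1 - x2)). pose proof (Rabs_pos (y1 - y2)).
  apply Rplus_le_compat.
  - apply Rmult_le_compat_r; nra.
  - rewrite Rmult_comm. now apply Rmult_le_compat_r.
Qed.

(** The intervals [-a_n, a_n] may be fixed or grow: the limit solves the system on
    every interval that U-many of them contain. *)
Lemma fronts_tend (U : (nat -> Prop) -> Prop) {HU : ProperFilter U}
    (b h r e c : R) (an cn : nat -> R) (phin psin : nat -> R -> R) :
  (forall P, U P \/ U (fun n => ~ P n)) ->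
  0 < b -> 0 < h -> 1 < r -> 0 < e <= 1 ->
  (forall n, 0 <= cn n <= 3 + b) -> tends U cn c ->
  (forall n, truncated_front (an n) b h r e (cn n) (phin n) (psin n)) ->
  exists phi psi,
    (forall t, tends U (fun n => phin n t) (phi t)) /\
    (forall t, tends U (fun n => psin n t) (psi t)) /\
    lip (slope b r) phi /\ lip (slope b r) psi /\
    forall l u, U (fun n => - an n <= l /\ u <= an n) ->
      system_on l u b h r e c phi psi.
Proof.
  intros Hultra Hb Hh Hr He Hcn Tc HT.
  assert (HL := slope_pos b r Hb Hr). set (L := slope b r) in *.
  assert (Bphi : forall n t, 0 <= phin n t <= 1) by (intros n; apply HT).
  assert (Bpsi : forall n t, 0 <= psin n t <= 1).
  { intros n. destruct (HT n) as [_ [[H _] _]]. exact H. }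
  assert (Lphi : forall n, lip L (phin n)) by (intros n; apply HT).
  assert (Lpsi : forall n, lip L (psin n)).
  { intros n. destruct (HT n) as [_ [_ [_ [H _]]]]. exact H. }
  assert (Ex : forall f : nat -> R -> R, (forall n t, 0 <= f n t <= 1) ->
    exists x : R -> R, forall t, tends U (fun n => f n t) (x t)).
  { intros f Bf. apply (choice (fun t l => tends U (fun n => f n t) l)). intros t.
    apply (ultrafilter_bounded_tends U _ 1 Hultra). apply filter_forall. intros n.
    apply Rabs_le. specialize (Bf n t). lra. }
  assert (Lim : forall (f : nat -> R -> R) x, (forall n, lip L (f n)) ->
    (forall t, tends U (fun n => f n t) (x t)) -> lip L x).
  { intros f x Lf Tf s t. apply (tends_abs_le U (fun n => f n s - f n t)).
    - apply (tends_minus U); auto.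
    - apply filter_forall. intros n. apply Lf. }
  destruct (Ex phin Bphi) as [phi Tphi]. destruct (Ex psin Bpsi) as [psi Tpsi].
  exists phi, psi. split; [exact Tphi|]. split; [exact Tpsi|].
  split; [exact (Lim _ _ Lphi Tphi)|]. split; [exact (Lim _ _ Lpsi Tpsi)|].
  intros l u Hlu.
  (* The delay varies with n; the uniform Lipschitz bound absorbs the variation. *)
  assert (Tdelay : forall t, tends U (fun n => psin n (t - cn n * h)) (psi (t - c * h))).
  { intros t. apply (tends_iff U). intros eps Heps.
    assert (Hd : 0 < eps / (2 * (L * h))).
    { apply Rdiv_lt_0_compat; [lra|]. apply Rmult_lt_0_compat; [lra|]. nra. }
    assert (A := proj1 (tends_iff U _ _) Tc _ Hd).
    assert (B := proj1 (tends_iff U _ _) (Tpsi (t - c * h)) (eps / 2) ltac:(lra)).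
    apply: filter_imp (filter_and _ _ A B) => n [An Bn].
    assert (Ln := Lpsi n (t - cn n * h) (t - c * h)).
    replace (t - cn n * h - (t - c * h)) with (- h * (cn n - c)) in Ln by ring.
    rewrite Rabs_mult Rabs_Ropp (Rabs_pos_eq h) in Ln; [|lra].
    assert (L * (h * Rabs (cn n - c)) < eps / 2).
    { replace (eps / 2) with (L * h * (eps / (2 * (L * h)))) by (field; nra).
      rewrite -Rmult_assoc. apply Rmult_lt_compat_l; [nra|exact An]. }
    replace (_ - _) with ((psin n (t - cn n * h) - psin n (t - c * h))
       + (psin n (t - c * h) - psi (t - c * h))) by ring.
    apply Rle_lt_trans with (1 := Rabs_triang _ _). lra. }
  split.
  - apply (ode_on_tends U l u (3 + b) L (1 + r) ((3 + 2 * r) * L + r * L) c cn phin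
      (fun n t => react_u r (phin n t) (psin n (t - cn n * h)))); auto; try nra.
    + intros n t. apply react_u_abs_le; auto.
    + intros n s t. eapply Rle_trans; [apply react_u_lip; auto|].
      assert (A := Lphi n s t). assert (B := Lpsi n (s - cn n * h) (t - cn n * h)).
      replace (s - cn n * h - (t - cn n * h)) with (s - t) in B by ring.
      rewrite (Rmult_plus_distr_r ((3 + 2 * r) * L)). apply Rplus_le_compat;
        rewrite Rmult_assoc; apply Rmult_le_compat_l; lra.
    + apply: filter_imp Hlu => n [H1 H2].
      destruct (HT n) as [_ [_ [_ [_ [O _]]]]]. eapply ode_on_sub; eauto.
    + intros t. unfold react_u. apply (tends_mult U); [apply Tphi|].
      apply (tends_plus U).
      * apply (tends_minus U); [ |apply Tphi]. apply (tends_const U).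
      * apply (tends_mult U); [apply (tends_const U)|apply Tdelay].
  - apply (ode_on_tends U l u (3 + b) L (b + 1) (b * L + (3 + b) * L) c cn psin
      (fun n t => react_v b e (phin n t) (psin n t))); auto; try nra.
    + intros n t. apply react_v_abs_le; auto.
    + intros n s t. eapply Rle_trans; [apply react_v_lip; auto|].
      assert (A := Lphi n s t). assert (B := Lpsi n s t).
      rewrite (Rmult_plus_distr_r (b * L)). apply Rplus_le_compat;
        rewrite Rmult_assoc; apply Rmult_le_compat_l; lra.
    + apply: filter_imp Hlu => n [H1 H2].
      destruct (HT n) as [_ [_ [_ [_ [_ O]]]]]. eapply ode_on_sub; eauto.
    + intros t. unfold react_v. apply (tends_mult U).
      * apply (tends_minus U); (apply (tends_mult U); [apply (tends_const U)|]);
        [apply Tphi|apply Tpsi].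
      * apply (tends_minus U); [ |apply Tpsi]. apply (tends_const U).
Qed.

Lemma tends_of_eventually (U : (nat -> Prop) -> Prop) {HU : Filter U} (u : nat -> R) (l : R) :
  (forall P, eventually P -> U P) ->
  (forall n, Rabs (u n - l) <= / (INR n + 1)) -> tends U u l.
Proof.
  intros HE H. apply (tends_iff U). intros eps He. apply HE.
  destruct (archimed_cor1 eps He) as [N [HN HN0]].
  exists N. intros n Hn. apply Rle_lt_trans with (1 := H n).
  apply Rle_lt_trans with (2 := HN). apply Rinv_le_contravar.
  - now apply lt_0_INR.
  - apply le_INR in Hn. lra.
Qed.

(** Let cs be the supremum of the speeds admitting a front with psi(0) >= d.
    Limits of fronts with speeds tending to cs from below and from above are fronts
    at speed cs with psi(0) >= d and psi(0) <= d; by uniqueness they coincide. *)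
Lemma balanced_truncated_front (a b h r e d : R) :
  1 / 2 <= a -> 0 < b -> 0 < h -> 1 < r -> 0 < e <= 1 ->
  (forall phi psi, truncated_front a b h r e 0 phi psi -> d <= psi 0) ->
  exp (- a) < d ->
  exists c phi psi, 0 <= c <= 3 + b /\
    truncated_front a b h r e c phi psi /\ psi 0 = d.
Proof.
  intros Ha Hb Hh Hr He Hslow Hfast.
  destruct nat_ultrafilter as [U [HU [HE Hultra]]].
  set (high := fun c => 0 <= c <= 3 + b /\
    exists phi psi, truncated_front a b h r e c phi psi /\ d <= psi 0).
  destruct (completeness high) as [cs [Hub Hlub]].
  { exists (3 + b). intros c [Hc _]. lra. }
  { exists 0. split; [lra|].
    destruct (truncated_front_exists a b h r e 0) as [phi [psi T]]; try lra.
    exists phi, psi. split; [exact T|]. now apply (Hslow phi). }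
  assert (Hcs : 0 <= cs <= 3 + b).
  { split.
    - apply Hub. split; [lra|].
      destruct (truncated_front_exists a b h r e 0) as [phi [psi T]]; try lra.
      exists phi, psi. split; [exact T|]. now apply (Hslow phi).
    - apply Hlub. intros c [Hc _]. lra. }
  assert (Lim : forall (cn : nat -> R) (phin psin : nat -> R -> R),
    (forall n, 0 <= cn n <= 3 + b) ->
    (forall n, Rabs (cn n - cs) <= / (INR n + 1)) ->
    (forall n, truncated_front a b h r e (cn n) (phin n) (psin n)) ->
    exists phi psi, truncated_front a b h r e cs phi psi /\
      tends U (fun n => psin n 0) (psi 0)).
  { intros cn phin psin Bcn Tcn HT.
    destruct (fronts_tend U b h r e cs (fun _ => a) cn phin psin) as
      [phi [psi [Tphi [Tpsi [Lphi [Lpsi S]]]]]]; auto.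
    { now apply (tends_of_eventually U). }
    exists phi, psi. split; [|apply Tpsi].
    assert (Pr : forall f x, (forall n, profile a (f n)) ->
      (forall t, tends U (fun n => f n t) (x t)) -> profile a x).
    { intros f x Pf Tf. split; [|split].
      - intros t. split.
        + apply (tends_le U _ _ _ _ (tends_const U 0) (Tf t)).
          apply filter_forall. intros n. apply Pf.
        + apply (tends_le U _ _ _ _ (Tf t) (tends_const U 1)).
          apply filter_forall. intros n. apply Pf.
      - intros t Ht. apply (tends_unique U _ _ _ (Tf t)).
        apply (filterlim_ext (fun _ => 0)); [|apply (tends_const U)].
        intros n. symmetry. now apply Pf.
      - intros t Ht. apply (tends_unique U _ _ _ (Tf t)).
        apply (filterlim_ext (fun _ => 1)); [|apply (tends_const U)].
        intros n. symmetry. now apply Pf. }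
    split; [|split; [|split; [|split]]]; auto.
    - apply (Pr phin); auto. intros n. apply HT.
    - apply (Pr psin); auto. intros n. destruct (HT n) as [_ [Q _]]. exact Q.
    - apply S. apply filter_forall. intros _. lra. }
  assert (Inv : forall n : nat, 0 < / (INR n + 1) <= 1).
  { intros n. assert (A := pos_INR n). split; [apply Rinv_0_lt_compat; lra|].
    rewrite -Rinv_1. apply Rinv_le_contravar; lra. }
  assert (Low : exists phi psi, truncated_front a b h r e cs phi psi /\ d <= psi 0).
  { assert (A : forall n : nat, exists w : R * (R -> R) * (R -> R),
      let '(c, phi, psi) := w in 0 <= c <= 3 + b /\ Rabs (c - cs) <= / (INR n + 1) /\
      truncated_front a b h r e c phi psi /\ d <= psi 0).
    { intros n. specialize (Inv n).
      assert (B : exists c, high c /\ cs - / (INR n + 1) < c).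
      { apply NNPP. intros N. enough (cs <= cs - / (INR n + 1)) by lra.
        apply Hlub. intros c Hc. apply Rnot_lt_le. intros Hlt. apply N. now exists c. }
      destruct B as [c [Hc Hlt]]. assert (B := Hub c Hc).
      destruct Hc as [Hc [phi [psi [T Hd]]]].
      exists (c, phi, psi). split; [exact Hc|]. split; [|now split].
      apply Rabs_le. lra. }
    destruct (choice _ A) as [w Hw].
    destruct (Lim (fun n => fst (fst (w n))) (fun n => snd (fst (w n))) (fun n => snd (w n)))
      as [phi [psi [T Tpsi]]].
    { intros n. specialize (Hw n). destruct (w n) as [[c phi] psi]. apply Hw. }
    { intros n. specialize (Hw n). destruct (w n) as [[c phi] psi]. apply Hw. }
    { intros n. specialize (Hw n). destruct (w n) as [[c phi] psi]. apply Hw. }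
    exists phi, psi. split; [exact T|].
    apply (tends_le U _ _ _ _ (tends_const U d) Tpsi). apply filter_forall. intros n.
    specialize (Hw n). destruct (w n) as [[c phi'] psi']. apply Hw. }
  destruct Low as [phi [psi [T Hd]]].
  assert (Hcs' : cs < 3 + b).
  { destruct (Req_dec cs (3 + b)) as [E|]; [|lra]. exfalso.
    rewrite E in T. assert (A := fast_front_low a b h r e phi psi).
    assert (psi 0 <= exp (- a)) by (apply A; auto; lra). lra. }
  assert (A : forall n : nat, exists w : R * (R -> R) * (R -> R),
      let '(c, phi, psi) := w in 0 <= c <= 3 + b /\ Rabs (c - cs) <= / (INR n + 1) /\
      truncated_front a b h r e c phi psi /\ psi 0 < d).
  { intros n. specialize (Inv n).
    set (c := cs + Rmin (3 + b - cs) (/ (INR n + 1))).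
    assert (A1 := Rmin_l (3 + b - cs) (/ (INR n + 1))).
    assert (A2 := Rmin_r (3 + b - cs) (/ (INR n + 1))).
    assert (A3 : 0 < Rmin (3 + b - cs) (/ (INR n + 1))) by (apply Rmin_glb_lt; lra).
    assert (Hc : 0 <= c <= 3 + b) by (unfold c; lra).
    destruct (truncated_front_exists a b h r e c) as [phi' [psi' T']]; try lra.
    exists (c, phi', psi'). split; [exact Hc|]. split; [|split; [exact T'|]].
    - unfold c. apply Rabs_le. lra.
    - apply Rnot_le_lt. intros N. enough (c <= cs) by (unfold c in *; lra).
      apply Hub. split; [exact Hc|]. now exists phi', psi'. }
  destruct (choice _ A) as [w Hw].
  destruct (Lim (fun n => fst (fst (w n))) (fun n => snd (fst (w n))) (fun n => snd (w n)))
    as [phi' [psi' [T' Tpsi']]].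
  { intros n. specialize (Hw n). destruct (w n) as [[c phi'] psi']. apply Hw. }
  { intros n. specialize (Hw n). destruct (w n) as [[c phi'] psi']. apply Hw. }
  { intros n. specialize (Hw n). destruct (w n) as [[c phi'] psi']. apply Hw. }
  assert (Hd' : psi' 0 <= d).
  { apply (tends_le U _ _ _ _ Tpsi' (tends_const U d)). apply filter_forall. intros n.
    specialize (Hw n). destruct (w n) as [[c phi''] psi'']. apply Rlt_le, Hw. }
  exists cs, phi, psi. split; [exact Hcs|]. split; [exact T|].
  assert (E := truncated_front_unique a b h r e cs phi psi phi' psi'
    ltac:(lra) Hb Hr He ltac:(lra) T T' 0). lra.
Qed.

(** * From bounded intervals to the whole line *)

Definition entire_front (b h r e c : R) (phi psi : R -> R) : Prop :=
  (forall t, 0 <= phi t <= 1) /\ (forall t, 0 <= psi t <= 1) /\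
  increasing phi /\ increasing psi /\
  lip (slope b r) phi /\ lip (slope b r) psi /\
  forall l u, system_on l u b h r e c phi psi.

(** The normalisation psi(0) = (r - 1) / r keeps the fronts from drifting to one
    of the ends of [-a, a] as a tends to infinity. *)
Lemma entire_front_exists (b h r e k : R) :
  0 < b -> 0 < h -> 1 < r -> 0 < e <= 1 ->
  0 < k -> k <= / (40 * r) -> k * k < b / (256 * (r * r)) ->
  e <= k * k / 4 -> e <= b / 8 ->
  exists c phi psi, 0 <= c /\ entire_front b h r e c phi psi /\ psi 0 = (r - 1) / r.
Proof.
  intros Hb Hh Hr He Hk Hk1 Hk2 He1 He2.
  set (d := (r - 1) / r).
  assert (Hd : 0 < d) by (apply Rdiv_lt_0_compat; lra).
  destruct nat_ultrafilter as [U [HU [HE Hultra]]].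
  (* Half-lengths from a0 on satisfy the requirements of all the estimates; the
     last one gives exp(- a) < d. *)
  set (a0 := Rmax (1 / 2) (Rmax (2 / k) (1 - ln d))).
  assert (H0 : 1 / 2 <= a0) by apply Rmax_l.
  assert (H1 : 2 / k <= a0) by (eapply Rle_trans; [apply Rmax_l|apply Rmax_r]).
  assert (H2 : 1 - ln d <= a0) by (eapply Rle_trans; [apply Rmax_r|apply Rmax_r]).
  assert (A : forall n : nat, exists w : R * (R -> R) * (R -> R),
      let '(c, phi, psi) := w in 0 <= c <= 3 + b /\
      truncated_front (a0 + INR n) b h r e c phi psi /\ psi 0 = d).
  { intros n. assert (P := pos_INR n).
    destruct (balanced_truncated_front (a0 + INR n) b h r e d) as [c [phi [psi W]]];
      auto; try lra.
    - intros phi psi T. apply Rlt_le.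
      apply (standing_front_high (a0 + INR n) b h r e k phi psi); auto; lra.
    - apply Rlt_le_trans with (exp (ln d)); [apply exp_increasing; lra|].
      right. now apply exp_ln.
    - now exists (c, phi, psi). }
  destruct (choice _ A) as [w Hw].
  set (cn := fun n => fst (fst (w n))). set (phin := fun n => snd (fst (w n))).
  set (psin := fun n => snd (w n)).
  assert (Bcn : forall n, 0 <= cn n <= 3 + b).
  { intros n. unfold cn. specialize (Hw n). destruct (w n) as [[c phi] psi]. apply Hw. }
  assert (HT : forall n, truncated_front (a0 + INR n) b h r e (cn n) (phin n) (psin n)).
  { intros n. unfold cn, phin, psin. specialize (Hw n).
    destruct (w n) as [[c phi] psi]. apply Hw. }
  assert (Hn0 : forall n, psin n 0 = d).
  { intros n. unfold psin. specialize (Hw n). destruct (w n) as [[c phi] psi]. apply Hw. }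
  destruct (ultrafilter_bounded_tends U cn (3 + b) Hultra) as [c Tc].
  { apply filter_forall. intros n. apply Rabs_le. specialize (Bcn n). lra. }
  destruct (fronts_tend U b h r e c (fun n => a0 + INR n) cn phin psin)
    as [phi [psi [Tphi [Tpsi [Lphi [Lpsi S]]]]]]; auto.
  assert (Lo : forall (f : nat -> R -> R) x, (forall n t, 0 <= f n t <= 1) ->
    (forall t, tends U (fun n => f n t) (x t)) -> forall t, 0 <= x t <= 1).
  { intros f x Bf Tf t. split.
    - apply (tends_le U _ _ _ _ (tends_const U 0) (Tf t)).
      apply filter_forall. intros n. apply Bf.
    - apply (tends_le U _ _ _ _ (Tf t) (tends_const U 1)).
      apply filter_forall. intros n. apply Bf. }
  assert (In : forall (f : nat -> R -> R) x, (forall n, increasing (f n)) ->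
    (forall t, tends U (fun n => f n t) (x t)) -> increasing x).
  { intros f x If Tf s t Hst. apply (tends_le U _ _ _ _ (Tf s) (Tf t)).
    apply filter_forall. intros n. now apply If. }
  assert (Inc : forall n, increasing (phin n) /\ increasing (psin n)).
  { intros n. assert (P := pos_INR n). specialize (Bcn n).
    apply (truncated_front_increasing (a0 + INR n) b h r e (cn n)); auto; lra. }
  exists c, phi, psi. split; [|split].
  - apply (tends_le U _ _ _ _ (tends_const U 0) Tc). apply filter_forall. intros n. apply Bcn.
  - split; [|split; [|split; [|split; [|split; [|split]]]]]; auto.
    + apply (Lo phin); auto. intros n. apply HT.
    + apply (Lo psin); auto. intros n. destruct (HT n) as [_ [[Q _] _]]. exact Q.
    + apply (In phin); auto. intros n. apply Inc.
    + apply (In psin); auto. intros n. apply Inc.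
    + intros l u. apply S. apply HE.
      destruct (nfloor_ex (Rabs l + Rabs u)) as [N HN].
      { pose proof (Rabs_pos l). pose proof (Rabs_pos u). lra. }
      exists (Datatypes.S N). intros n Hn. apply le_INR in Hn. rewrite S_INR in Hn.
      pose proof (Rabs_maj2 l). pose proof (Rle_abs u).
      pose proof (Rabs_pos l). pose proof (Rabs_pos u). lra.
  - apply (tends_unique U _ _ _ (Tpsi 0)).
    apply (filterlim_ext (fun _ => d)); [|apply (tends_const U)].
    intros n. symmetry. apply Hn0.
Qed.

(** * States of the front at infinity *)

Lemma increasing_limits (f : R -> R) :
  increasing f -> (forall t, 0 <= f t <= 1) ->
  exists lm lp, (forall t, lm <= f t <= lp) /\ 0 <= lm /\ lp <= 1 /\
    is_lim f m_infty lm /\ is_lim f p_infty lp.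
Proof.
  intros If Bf.
  destruct (completeness (fun y => exists t, y = f t)) as [lp [Hub Hlub]].
  { exists 1. intros y [t ->]. apply Bf. } { now exists (f 0), 0. }
  destruct (completeness (fun y => exists t, y = - f t)) as [lm [Hub' Hlub']].
  { exists 0. intros y [t ->]. specialize (Bf t). lra. } { now exists (- f 0), 0. }
  assert (B : forall t, - lm <= f t <= lp).
  { intros t. assert (f t <= lp) by (apply Hub; now exists t).
    assert (- f t <= lm) by (apply Hub'; now exists t). lra. }
  exists (- lm), lp. split; [exact B|]. split; [|split; [|split]].
  - enough (lm <= 0) by lra. apply Hlub'. intros y [t ->]. specialize (Bf t). lra.
  - apply Hlub. intros y [t ->]. apply Bf.
  - apply is_lim_spec. intros eps. assert (He := cond_pos eps).
    assert (X : exists s, f s < - lm + eps).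
    { apply NNPP. intros N. enough (lm <= lm - eps) by lra.
      apply Hlub'. intros y [t ->]. apply Rnot_lt_le. intros Hlt. apply N. exists t. lra. }
    destruct X as [s Hs]. exists s. intros t Ht.
    assert (A := If t s ltac:(lra)). specialize (B t).
    apply Rabs_lt_between. lra.
  - apply is_lim_spec. intros eps. assert (He := cond_pos eps).
    assert (X : exists s, lp - eps < f s).
    { apply NNPP. intros N. enough (lp <= lp - eps) by lra.
      apply Hlub. intros y [t ->]. apply Rnot_lt_le. intros Hlt. apply N. exists t. lra. }
    destruct X as [s Hs]. exists s. intros t Ht.
    assert (A := If s t ltac:(lra)). specialize (B t).
    apply Rabs_lt_between. lra.
Qed.

(** The two properties of a neighbourhood filter of an infinite end of the line
    that the study of end states uses: invariance under the delay, and arbitrarily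
    long intervals on which an eventual property holds. *)
Definition is_end (E : (R -> Prop) -> Prop) : Prop :=
  (forall P k, E P -> E (fun t => P (t - k))) /\
  (forall P l, E P -> 0 < l -> exists s, forall t, s <= t <= s + l -> P t).

Lemma is_end_p_infty : is_end (Rbar_locally' p_infty).
Proof.
  split.
  - intros P k [M HM]. exists (M + k). intros t Ht. apply HM. lra.
  - intros P l [M HM] Hl. exists (M + 1). intros t Ht. apply HM. lra.
Qed.

Lemma is_end_m_infty : is_end (Rbar_locally' m_infty).
Proof.
  split.
  - intros P k [M HM]. exists (M + k). intros t Ht. apply HM. lra.
  - intros P l [M HM] Hl. exists (M - l - 1). intros t Ht. apply HM. lra.
Qed.

(** The function x' - c x is bounded with derivative - g, so g cannot stay away
    from 0 with a constant sign on arbitrarily long intervals. *)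
Lemma reaction_vanishes_at_end (E : (R -> Prop) -> Prop) {HE : Filter E}
    (c L : R) (x g : R -> R) (gam : R) :
  is_end E -> 0 <= c -> lip L x -> (forall t, 0 <= x t <= 1) ->
  (forall l u, ode_on l u c x g) -> tends E g gam -> gam = 0.
Proof.
  intros [_ Hlong] Hc Lx Bx O Tg. apply NNPP. intros N.
  assert (D : forall t, is_derive x t (Derive x t)).
  { intros t. apply (ode_on_derive _ _ _ _ _ (O (t - 1) (t + 1))). lra. }
  set (w := fun t => Derive x t - c * x t).
  assert (Dw : forall t, is_derive w t (- g t)).
  { intros t. derive_value ((c * Derive x t - g t) - c * Derive x t).
    apply: is_derive_minus.
    - apply (O (t - 1) (t + 1)). lra.
    - apply: is_derive_scal. apply D. }
  assert (Bw : forall t, Rabs (w t) <= L + c).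
  { intros t. assert (A := lip_derive _ _ _ _ Lx (D t)). apply Rabs_le_between in A.
    specialize (Bx t). apply Rabs_le. unfold w. nra. }
  assert (Pg := Rabs_pos_lt gam N).
  assert (HL : 0 <= L + c) by (eapply Rle_trans; [apply Rabs_pos|apply (Bw 0)]).
  (* Over this length a source of size |gam| / 2 changes x' - c x by more than
     twice its bound L + c. *)
  set (l := (4 * (L + c) + 4) / Rabs gam).
  assert (Hl : 0 < l) by (apply Rdiv_lt_0_compat; lra).
  destruct (Hlong _ l (proj1 (tends_iff E g gam) Tg (Rabs gam / 2) ltac:(lra)) Hl)
    as [s Hs].
  destruct (mean_value w (fun t => - g t) s (s + l)) as [y [Hy Ey]]; auto; try lra.
  { intros t _. eapply derive_continuous, Dw. }
  assert (A := Hs y ltac:(lra)).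
  assert (Q : Rabs gam / 2 < Rabs (g y)).
  { pose proof (Rabs_triang_inv gam (g y)) as T. rewrite Rabs_minus_sym in T. lra. }
  assert (E1 : Rabs (w (s + l) - w s) = Rabs (g y) * l).
  { rewrite Ey. replace (s + l - s) with l by ring.
    rewrite Rabs_mult Rabs_Ropp (Rabs_pos_eq l); lra. }
  assert (E2 : Rabs (w (s + l) - w s) <= 2 * (L + c)).
  { pose proof (Bw s) as W1. pose proof (Bw (s + l)) as W2.
    apply Rabs_le_between in W1. apply Rabs_le_between in W2. apply Rabs_le. lra. }
  assert (E3 : Rabs gam / 2 * l = 2 * (L + c) + 2) by (unfold l; field; lra).
  assert (Rabs gam / 2 * l <= Rabs (g y) * l) by (apply Rmult_le_compat_r; lra).
  lra.
Qed.

Lemma end_states_are_equilibria (E : (R -> Prop) -> Prop) {HE : Filter E}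
    (b h r e c : R) (phi psi : R -> R) (x y : R) :
  is_end E -> 0 <= c -> entire_front b h r e c phi psi ->
  tends E phi x -> tends E psi y -> react_u r x y = 0 /\ react_v b e x y = 0.
Proof.
  intros HEnd Hc [B1 [B2 [_ [_ [L1 [L2 S]]]]]] T1 T2.
  assert (T2' : tends E (fun t => psi (t - c * h)) y).
  { apply (tends_iff E). intros eps Heps.
    apply (proj1 HEnd (fun t => Rabs (psi t - y) < eps)).
    now apply (tends_iff E). }
  split.
  - apply (reaction_vanishes_at_end E c _ phi _ _ HEnd Hc L1 B1 (fun l u => proj1 (S l u))).
    unfold react_u. apply (tends_mult E); [exact T1|]. apply (tends_plus E).
    + apply (tends_minus E); [apply (tends_const E)|exact T1].
    + apply (tends_mult E); [apply (tends_const E)|exact T2'].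
  - apply (reaction_vanishes_at_end E c _ psi _ _ HEnd Hc L2 B2 (fun l u => proj2 (S l u))).
    unfold react_v. apply (tends_mult E).
    + apply (tends_minus E); (apply (tends_mult E); [apply (tends_const E)|assumption]).
    + apply (tends_minus E); [apply (tends_const E)|exact T2].
Qed.

(** With phi = 0 the function w = psi' - c psi has derivative
    e psi (1 - psi) >= 0, and it is nonnegative because psi' >= 0 and psi tends to 0
    at minus infinity.  Past 0 it is bounded below by a positive constant, and so
    is psi'. *)
Lemma no_front_with_vanishing_phi (b h r e c : R) (phi psi : R -> R) :
  0 < e -> 0 <= c -> entire_front b h r e c phi psi ->
  is_lim psi m_infty 0 -> 0 < psi 0 < 1 -> ~ (forall t, phi t = 0).
Proof.
  intros He Hc [B1 [B2 [I1 [I2 [L1 [L2 S]]]]]] Hm Hd Z.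
  assert (O := fun l u => proj2 (S l u)).
  assert (D : forall t, is_derive psi t (Derive psi t)).
  { intros t. apply (ode_on_derive _ _ _ _ _ (O (t - 1) (t + 1))). lra. }
  assert (N : forall t, 0 <= Derive psi t).
  { intros t. now apply (increasing_derive_nonneg psi t). }
  set (w := fun t => Derive psi t - c * psi t).
  assert (Dw : forall t, is_derive w t (e * (psi t * (1 - psi t)))).
  { intros t. replace (e * _) with
      ((c * Derive psi t - react_v b e (phi t) (psi t)) - c * Derive psi t)
      by (unfold react_v; rewrite Z; ring).
    apply: is_derive_minus.
    - apply (O (t - 1) (t + 1)). lra.
    - apply: is_derive_scal. apply D. }
  assert (Iw : forall s t, s <= t -> w s <= w t).
  { intros s t Hst.
    apply (nondecreasing_of_derive w (fun t => e * (psi t * (1 - psi t))) s t Hst).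
    - intros q _. split; [apply Dw|]. specialize (B2 q).
      apply Rmult_le_pos; [lra|]. apply Rmult_le_pos; lra.
    - intros q _. eapply derive_continuous, Dw. }
  assert (Pw : 0 <= w 0).
  { apply Rnot_lt_le. intros Hlt.
    apply is_lim_spec in Hm.
    assert (He' : 0 < - w 0 / (c + 1)) by (apply Rdiv_lt_0_compat; lra).
    destruct (Hm (mkposreal _ He')) as [M HM]. simpl in HM.
    set (s := Rmin (M - 1) (- 1)).
    assert (s <= M - 1) by apply Rmin_l. assert (s <= - 1) by apply Rmin_r.
    assert (A := HM s ltac:(lra)). rewrite Rminus_0_r Rabs_pos_eq in A; [|apply B2].
    assert (A' := Iw s 0 ltac:(lra)). unfold w in A' at 1. specialize (N s).
    assert (c * psi s <= (c + 1) * psi s) by (apply Rmult_le_compat_r; [apply B2|lra]).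
    assert ((c + 1) * psi s < (c + 1) * (- w 0 / (c + 1)))
      by (apply Rmult_lt_compat_l; lra).
    assert ((c + 1) * (- w 0 / (c + 1)) = - w 0) by (field; lra). lra. }
  destruct (derive_pos_increases w 0 _ (Dw 0)) as [eta [Heta [A _]]].
  { apply Rmult_lt_0_compat; [lra|]. apply Rmult_lt_0_compat; lra. }
  specialize (A (eta / 2) ltac:(lra)).
  set (s := eta / 2) in *. set (m := w s) in *.
  destruct (mean_value psi (Derive psi) s (s + 2 / m)) as [y [Hy E]]; auto.
  { assert (0 < 2 / m) by (apply Rdiv_lt_0_compat; lra). lra. }
  { intros x _. eapply derive_continuous, D. }
  assert (W := Iw s y ltac:(lra)). unfold w at 2 in W. fold m in W.
  assert (0 <= c * psi y) by (apply Rmult_le_pos; [exact Hc|apply B2]).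
  assert (Q1 := B2 s). assert (Q2 := B2 (s + 2 / m)).
  replace (s + 2 / m - s) with (2 / m) in E by ring.
  assert (m * (2 / m) <= Derive psi y * (2 / m)).
  { apply Rmult_le_compat_r; [|lra]. apply Rlt_le, Rdiv_lt_0_compat; lra. }
  assert (m * (2 / m) = 2) by (field; lra). lra.
Qed.

(** Put X = x - phi and V = y - psi.  Then X'' - c X' <= phi (X - r V), because
    V(t - c h) >= V(t) for c >= 0, and V'' - c V' = (1 - psi) (e V - b X).
    A positive combination z of X and V makes both coefficients negative near
    (x, y), which is possible since e < b r.  Then Y = z' - c z is
    nonincreasing, nonpositive, and arbitrarily close to 0 far to the right, hence
    0; so X and V vanish there. *)
Lemma no_front_to_intermediate_state (b h r e c x y : R) (phi psi : R -> R) :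
  0 < b -> 0 < h -> 1 < r -> 0 < e -> e < b -> 0 <= c ->
  entire_front b h r e c phi psi ->
  (forall t, phi t <= x) -> (forall t, psi t <= y) ->
  is_lim phi m_infty 0 -> is_lim phi p_infty x -> is_lim psi p_infty y ->
  0 < x -> y < 1 -> 1 - r - x + r * y = 0 -> b * x - e * y = 0 -> False.
Proof.
  intros Hb Hh Hr He Heb Hc HW Hx Hy Hm Tp Tq X0 Y1 E1 E2.
  destruct HW as [B1 [B2 [I1 [I2 [L1 [L2 S]]]]]].
  assert (D1 : forall t, is_derive phi t (Derive phi t)).
  { intros t. apply (ode_on_derive _ _ _ _ _ (proj1 (S (t - 1) (t + 1)))). lra. }
  assert (D2 : forall t, is_derive psi t (Derive psi t)).
  { intros t. apply (ode_on_derive _ _ _ _ _ (proj2 (S (t - 1) (t + 1)))). lra. }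
  assert (N1 : forall t, 0 <= Derive phi t).
  { intros t. now apply (increasing_derive_nonneg phi t). }
  assert (N2 : forall t, 0 <= Derive psi t).
  { intros t. now apply (increasing_derive_nonneg psi t). }
  (* Any m strictly between e / r and b will do. *)
  set (m := (e / r + b) / 2).
  assert (Her : e / r < e).
  { apply Rmult_lt_reg_r with r; [lra|]. unfold Rdiv. rewrite Rmult_assoc Rinv_l; nra. }
  assert (Her0 : 0 < e / r) by (apply Rdiv_lt_0_compat; lra).
  assert (Hm1 : m < b) by (unfold m; lra).
  assert (Hm2 : e < m * r).
  { replace e with (e / r * r) by (field; lra). apply Rmult_lt_compat_r; unfold m; lra. }
  set (al := m / x). set (be := 1 / (1 - y)).
  assert (Hal : 0 < al) by (apply Rdiv_lt_0_compat; unfold m; lra).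
  assert (Hbe : 0 < be) by (apply Rdiv_lt_0_compat; lra).
  set (A := fun t => al * phi t - be * b * (1 - psi t)).
  set (B := fun t => be * e * (1 - psi t) - al * r * phi t).
  set (Ep := Rbar_locally' p_infty).
  assert (FE : Filter Ep) by apply filter_filter.
  assert (TA : tends Ep A (m - b)).
  { replace (m - b) with (al * x - be * b * (1 - y)) by (unfold al, be; field; lra).
    apply (tends_minus Ep); (apply (tends_mult Ep); [apply (tends_const Ep)|]).
    - exact Tp.
    - apply (tends_minus Ep); [apply (tends_const Ep)|exact Tq]. }
  assert (TB : tends Ep B (e - m * r)).
  { replace (e - m * r) with (be * e * (1 - y) - al * r * x) by (unfold al, be; field; lra).
    apply (tends_minus Ep); (apply (tends_mult Ep); [apply (tends_const Ep)|]).
    - apply (tends_minus Ep); [apply (tends_const Ep)|exact Tq].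
    - exact Tp. }
  set (z := fun t => al * (x - phi t) + be * (y - psi t)).
  assert (Tz : tends Ep z 0).
  { replace 0 with (al * (x - x) + be * (y - y)) by ring.
    apply (tends_plus Ep); (apply (tends_mult Ep); [apply (tends_const Ep)|]);
      (apply (tends_minus Ep); [apply (tends_const Ep)|assumption]). }
  assert (Neg : Ep (fun t => A t < 0 /\ B t < 0)).
  { assert (NA : Ep (fun t => Rabs (A t - (m - b)) < b - m))
      by (apply (tends_iff Ep A (m - b)); [exact TA|lra]).
    assert (NB : Ep (fun t => Rabs (B t - (e - m * r)) < m * r - e))
      by (apply (tends_iff Ep B (e - m * r)); [exact TB|lra]).
    generalize (@filter_and _ Ep FE _ _ NA NB).
    apply (@filter_imp _ Ep FE). intros t [H1 H2].
    apply Rabs_lt_between in H1. apply Rabs_lt_between in H2. lra. }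
  destruct Neg as [T HT].
  set (z1 := fun t => - (al * Derive phi t + be * Derive psi t)).
  assert (Dz : forall t, is_derive z t (z1 t)).
  { intros t. unfold z, z1.
    derive_value (al * (0 - Derive phi t) + be * (0 - Derive psi t)).
    apply: is_derive_plus; apply: is_derive_scal; apply: is_derive_minus; auto;
      apply: is_derive_const. }
  set (Y := fun t => z1 t - c * z t).
  assert (DY : forall t, is_derive Y t
     (al * react_u r (phi t) (psi (t - c * h)) + be * react_v b e (phi t) (psi t))).
  { intros t. unfold Y.
    derive_value
     (- (al * (c * Derive phi t - react_u r (phi t) (psi (t - c * h)))
         + be * (c * Derive psi t - react_v b e (phi t) (psi t)))
      - c * - (al * Derive phi t + be * Derive psi t)).
    apply: is_derive_minus; [|apply: is_derive_scal; apply Dz].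
    apply: is_derive_opp. apply: is_derive_plus; apply: is_derive_scal.
    - apply (proj1 (S (t - 1) (t + 1))). lra.
    - apply (proj2 (S (t - 1) (t + 1))). lra. }
  (* The inequality uses psi(t - c h) <= psi(t). *)
  assert (Bd : forall t,
     al * react_u r (phi t) (psi (t - c * h)) + be * react_v b e (phi t) (psi t)
       <= A t * (x - phi t) + B t * (y - psi t)).
  { intros t. unfold react_u, react_v, A, B.
    replace (1 - r - phi t + r * psi (t - c * h)) with
      ((x - phi t) - r * (y - psi (t - c * h))) by lra.
    replace (b * phi t - e * psi t) with (e * (y - psi t) - b * (x - phi t)) by lra.
    assert (Q := I2 (t - c * h) t ltac:(nra)). assert (Q' := B1 t).
    assert (0 <= al * r * phi t * (psi t - psi (t - c * h))).
    { apply Rmult_le_pos; [|lra]. apply Rmult_le_pos; [nra|lra]. }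
    nra. }
  assert (Yneg : forall t, Y t <= 0).
  { intros t. unfold Y, z1, z. specialize (N1 t). specialize (N2 t).
    specialize (Hx t). specialize (Hy t).
    assert (0 <= al * Derive phi t) by (apply Rmult_le_pos; lra).
    assert (0 <= be * Derive psi t) by (apply Rmult_le_pos; lra).
    assert (0 <= al * (x - phi t)) by (apply Rmult_le_pos; lra).
    assert (0 <= be * (y - psi t)) by (apply Rmult_le_pos; lra).
    assert (0 <= c * (al * (x - phi t) + be * (y - psi t))) by (apply Rmult_le_pos; lra).
    lra. }
  assert (Ydec : forall s t, T < s -> s <= t -> Y t <= Y s).
  { intros s t Hs Hst. eapply nonincreasing_of_derive; [exact Hst| |].
    - intros q Hq. split; [apply DY|].
      destruct (HT q ltac:(lra)) as [HA HB]. specialize (Bd q).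
      specialize (Hx q). specialize (Hy q). nra.
    - intros q _. eapply derive_continuous, DY. }
  assert (Ypos : forall t, T < t -> 0 <= Y t).
  { intros t Ht. apply Rnot_lt_le. intros Hlt.
    set (eps := - Y t / (2 * (c + 2))).
    assert (Heps : 0 < eps) by (apply Rdiv_lt_0_compat; lra).
    destruct (proj1 (tends_iff Ep _ _) Tz eps Heps) as [M HM].
    set (s := Rmax t M + 1).
    assert (t <= Rmax t M) by apply Rmax_l. assert (M <= Rmax t M) by apply Rmax_r.
    destruct (mean_value z z1 s (s + 1)) as [q [Hq Eq]]; auto; try lra.
    { intros q _. eapply derive_continuous, Dz. }
    assert (Q1 := HM s ltac:(unfold s; lra)).
    assert (Q2 := HM (s + 1) ltac:(unfold s; lra)).
    assert (Q3 := HM q ltac:(unfold s in *; lra)).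
    rewrite Rminus_0_r in Q1. rewrite Rminus_0_r in Q2. rewrite Rminus_0_r in Q3.
    apply Rabs_lt_between in Q1. apply Rabs_lt_between in Q2. apply Rabs_lt_between in Q3.
    assert (W := Ydec t q Ht ltac:(unfold s in *; lra)). unfold Y in W at 1.
    assert (c * z q <= c * eps) by (apply Rmult_le_compat_l; lra).
    assert (eps * (c + 2) = - Y t / 2) by (unfold eps; field; lra).
    lra. }
  set (t0 := T + 1).
  assert (Z0 : phi t0 = x).
  { destruct (HT t0 ltac:(unfold t0; lra)) as [HA HB].
    assert (Bd0 := Bd t0).
    set (dY := al * react_u r (phi t0) (psi (t0 - c * h)) + be * react_v b e (phi t0) (psi t0)) in *.
    assert (0 <= dY).
    { apply Rnot_lt_le. intros Hlt.
      destruct (derive_pos_increases (fun s => - Y s) t0 (- dY)) as [eta [He' [W _]]].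
      { apply: is_derive_opp. apply DY. } { lra. }
      specialize (W (t0 + eta / 2) ltac:(lra)).
      assert (Y0 := Yneg t0). assert (Y0' := Ypos (t0 + eta / 2)). unfold t0 in *. lra. }
    specialize (Hx t0). specialize (Hy t0). nra. }
  assert (Const : forall t, t < t0 -> phi t = x).
  { intros t Ht. enough (x - phi t = 0) by lra.
    apply (strong_max_principle t (t0 + 1) c 1 (fun t => x - phi t)
      (fun t => 0 - react_u r (phi t) (psi (t - c * h))) t0); try lra.
    - apply ode_on_minus; [apply ode_on_const|apply S].
    - intros s _. unfold react_u.
      replace (1 - r - phi s + r * psi (s - c * h)) with
        ((x - phi s) - r * (y - psi (s - c * h))) by lra.
      assert (Q1 := B1 s). assert (Q2 := Hx s). assert (Q3 := Hy (s - c * h)).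
      assert (0 <= phi s * (r * (y - psi (s - c * h)))).
      { apply Rmult_le_pos; [lra|]. apply Rmult_le_pos; lra. }
      nra.
    - intros s _. specialize (Hx s). lra.
    - intros s _. apply: continuous_minus; [apply: continuous_const|].
      eapply lip_continuous; eauto. }
  apply is_lim_spec in Hm. destruct (Hm (mkposreal x X0)) as [M HM]. simpl in HM.
  set (s := Rmin (M - 1) (t0 - 1)).
  assert (s <= M - 1) by apply Rmin_l. assert (s <= t0 - 1) by apply Rmin_r.
  assert (W := HM s ltac:(lra)). rewrite (Const s) in W; [|lra].
  rewrite Rminus_0_r Rabs_pos_eq in W; lra.
Qed.

(** At minus infinity psi is at most (r - 1) / r < 1, which among the equilibria
    leaves (0,0) only. *)
Lemma entire_front_limits (b h r e c : R) (phi psi : R -> R) :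
  0 < b -> 0 < h -> 1 < r -> 0 < e -> e < b -> 0 <= c ->
  entire_front b h r e c phi psi -> psi 0 = (r - 1) / r ->
  is_lim phi m_infty 0 /\ is_lim psi m_infty 0 /\
  is_lim phi p_infty 1 /\ is_lim psi p_infty 1.
Proof.
  intros Hb Hh Hr He Heb Hc HW H0.
  assert (Hd : 0 < psi 0 /\ r * psi 0 = r - 1).
  { rewrite H0. split; [apply Rdiv_lt_0_compat; lra|field; lra]. }
  assert (HW' := HW). destruct HW' as [B1 [B2 [I1 [I2 _]]]].
  destruct (increasing_limits phi I1 B1) as [xm [xp [Bx [Px [Qx [Xm Xp]]]]]].
  destruct (increasing_limits psi I2 B2) as [ym [yp [By [Py [Qy [Ym Yp]]]]]].
  assert (FM : Filter (Rbar_locally' m_infty)) by apply filter_filter.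
  assert (FP : Filter (Rbar_locally' p_infty)) by apply filter_filter.
  destruct (end_states_are_equilibria (Rbar_locally' m_infty) b h r e c phi psi xm ym
    is_end_m_infty Hc HW Xm Ym) as [Fm Gm].
  destruct (end_states_are_equilibria (Rbar_locally' p_infty) b h r e c phi psi xp yp
    is_end_p_infty Hc HW Xp Yp) as [Fp Gp].
  unfold react_u, react_v in *. assert (By0 := By 0). assert (Bx0 := Bx 0).
  assert (Zx : xm = 0).
  { apply Rmult_integral in Fm. destruct Fm as [|Fm]; [assumption|]. nra. }
  assert (Zy : ym = 0).
  { subst xm. apply Rmult_integral in Gm. destruct Gm as [Gm|Gm]; nra. }
  subst xm ym.
  assert (Sy : yp = 1).
  { apply NNPP. intros N. apply Rmult_integral in Gp. destruct Gp as [Gp|Gp]; [|lra].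
    apply Rmult_integral in Fp. destruct Fp as [Fp|Fp]; [subst xp; nra|].
    apply (no_front_to_intermediate_state b h r e c xp yp phi psi); auto; try lra.
    - intros t. apply Bx.
    - intros t. apply By.
    - nra. }
  subst yp. split; [exact Xm|]. split; [exact Ym|]. split; [|exact Yp].
  apply Rmult_integral in Fp. destruct Fp as [Fp|Fp].
  - exfalso. apply (no_front_with_vanishing_phi b h r e c phi psi); auto.
    + split; nra.
    + intros t. specialize (Bx t). lra.
  - now replace 1 with xp by lra.
Qed.

(** * Travelling waves as classical solutions *)

Lemma travelling_C12 (c : R) (f f1 f2 : R -> R) :
  (forall s, is_derive f s (f1 s)) -> (forall s, is_derive f1 s (f2 s)) ->
  (forall s, continuous f2 s) ->
  C12 (fun t x => f (x + c * t)) /\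
  (forall t x, dt (fun t x => f (x + c * t)) t x = c * f1 (x + c * t)) /\
  (forall t x, dxx (fun t x => f (x + c * t)) t x = f2 (x + c * t)).
Proof.
  intros D1 D2 C2.
  assert (Dx : forall (g g1 : R -> R), (forall s, is_derive g s (g1 s)) ->
    forall t x, is_derive (fun y => g (y + c * t)) x (g1 (x + c * t))).
  { intros g g1 Dg t x. replace (g1 _) with (1 * g1 (x + c * t)) by ring.
    apply: (is_derive_comp g (fun y => y + c * t)); [apply Dg|].
    auto_derive; [trivial|ring]. }
  assert (Dt : forall t x, is_derive (fun s => f (x + c * s)) t (c * f1 (x + c * t))).
  { intros t x. apply: (is_derive_comp f (fun s => x + c * s)); [apply D1|].
    auto_derive; [trivial|ring]. }
  assert (Edx : dx (fun t x => f (x + c * t)) = fun t x => f1 (x + c * t)).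
  { do 2 (apply functional_extensionality; intro). unfold dx.
    apply is_derive_unique. now apply Dx. }
  assert (Edxx : dxx (fun t x => f (x + c * t)) = fun t x => f2 (x + c * t)).
  { do 2 (apply functional_extensionality; intro). unfold dxx. rewrite Edx. unfold dx.
    apply is_derive_unique. now apply Dx. }
  assert (Edt : dt (fun t x => f (x + c * t)) = fun t x => c * f1 (x + c * t)).
  { do 2 (apply functional_extensionality; intro). unfold dt.
    apply is_derive_unique. apply Dt. }
  assert (C2d : forall g : R -> R, (forall s, continuous g s) -> forall t x,
    continuity_2d_pt (fun t x => g (x + c * t)) t x).
  { intros g Cg t x.
    apply (continuity_1d_2d_pt_comp g (fun t x => x + c * t)).
    - apply continuity_pt_filterlim, Cg.
    - apply continuity_2d_pt_plus; [apply continuity_2d_pt_id2|].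
      apply continuity_2d_pt_mult; [apply continuity_2d_pt_const|apply continuity_2d_pt_id1]. }
  assert (C1 : forall s, continuous f1 s) by (intros s; eapply derive_continuous, D2).
  assert (C0 : forall s, continuous f s) by (intros s; eapply derive_continuous, D1).
  split; [|split].
  - intros t x. rewrite Edx Edxx Edt.
    split; [eexists; apply Dt|]. split; [eexists; now apply Dx|].
    split; [eexists; now apply (Dx f1 f2)|].
    split; [now apply C2d|]. split; [|split; now apply C2d].
    apply continuity_2d_pt_mult; [apply continuity_2d_pt_const|now apply C2d].
  - intros t x. now rewrite Edt.
  - intros t x. now rewrite Edxx.
Qed.

Lemma entire_front_classical (b h r e c : R) (phi psi : R -> R) :
  entire_front b h r e c phi psi ->
  classical_solution b h r e
    (fun t x => phi (x + c * t)) (fun t x => psi (x + c * t)).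
Proof.
  intros [B1 [B2 [_ [_ [L1 [L2 S]]]]]].
  assert (D1 : forall t, is_derive phi t (Derive phi t)).
  { intros t. apply (ode_on_derive _ _ _ _ _ (proj1 (S (t - 1) (t + 1)))). lra. }
  assert (D2 : forall t, is_derive psi t (Derive psi t)).
  { intros t. apply (ode_on_derive _ _ _ _ _ (proj2 (S (t - 1) (t + 1)))). lra. }
  assert (E1 : forall t, is_derive (Derive phi) t
     (c * Derive phi t - react_u r (phi t) (psi (t - c * h)))).
  { intros t. apply (proj1 (S (t - 1) (t + 1))). lra. }
  assert (E2 : forall t, is_derive (Derive psi) t
     (c * Derive psi t - react_v b e (phi t) (psi t))).
  { intros t. apply (proj2 (S (t - 1) (t + 1))). lra. }
  assert (C1 := lip_continuous _ _ L1). assert (C2 := lip_continuous _ _ L2).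
  destruct (travelling_C12 c phi _ _ D1 E1) as [R1 [T1 X1]].
  { intros s. apply: continuous_minus.
    - apply: continuous_scal_r. eapply derive_continuous, E1.
    - apply (react_u_continuous r phi (fun t => psi (t - c * h))); [apply C1|].
      apply (continuous_comp (fun t => t - c * h) psi); [|apply C2].
      apply: continuous_minus; [apply: continuous_id|apply: continuous_const]. }
  destruct (travelling_C12 c psi _ _ D2 E2) as [R2 [T2 X2]].
  { intros s. apply: continuous_minus.
    - apply: continuous_scal_r. eapply derive_continuous, E2.
    - apply (react_v_continuous b e phi psi); auto. }
  split; [exact R1|]. split; [exact R2|].
  intros t x. split; [apply B1|]. split; [apply B2|].
  rewrite T1 X1 T2 X2. unfold react_u, react_v. split; [|ring].
  replace (x + c * (t - h)) with (x + c * t - c * h) by ring. ring.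
Qed.

Theorem theorem2p1 :
  forall b h r : R, 0 < b -> 0 < h -> 1 < r ->
  exists eps_bar : R, 0 < eps_bar /\
    forall eps : R, 0 < eps < eps_bar ->
      exists (c : R) (phi psi : R -> R),
        monotone_bistable_wavefront b h r eps c phi psi.
Proof.
  intros b h r Hb Hh Hr.
  (* As k < 1, the second bound also gives k * k < b / (256 r^2). *)
  set (k := Rmin (/ (40 * r)) (b / (256 * (r * r)))).
  assert (Q1 : 0 < / (40 * r)) by (apply Rinv_0_lt_compat; lra).
  assert (Q2 : 0 < b / (256 * (r * r))) by (apply Rdiv_lt_0_compat; nra).
  assert (Hk : 0 < k) by now apply Rmin_glb_lt.
  assert (Hk1 : k <= / (40 * r)) by apply Rmin_l.
  assert (Hk2 : k <= b / (256 * (r * r))) by apply Rmin_r.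
  assert (Hk3 : / (40 * r) < 1).
  { rewrite -Rinv_1. apply Rinv_lt_contravar; lra. }
  exists (Rmin (Rmin (k * k / 4) (b / 8)) 1). split.
  { apply Rmin_glb_lt; [apply Rmin_glb_lt; nra|lra]. }
  intros e [He0 He].
  assert (A1 := Rlt_le_trans _ _ _ He (Rmin_l _ _)).
  assert (A2 := Rlt_le_trans _ _ _ He (Rmin_r _ _)).
  assert (A3 := Rlt_le_trans _ _ _ A1 (Rmin_l _ _)).
  assert (A4 := Rlt_le_trans _ _ _ A1 (Rmin_r _ _)).
  destruct (entire_front_exists b h r e k) as [c [phi [psi [Hc [HW H0]]]]];
    try lra; try nra.
  exists c, phi, psi. split; [now apply entire_front_classical|].
  split; [intros s; split; apply HW|].
  split; [apply HW|]. split; [apply HW|].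
  apply (entire_front_limits b h r e c phi psi); auto; lra.
Qed.
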